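(* Let $x:[t_0,+\infty)\to\mathcal H$ be any strong global solution of the system $$\ddot x(t)+\alpha(t)\dot x(t)+\beta(t)\frac{d}{dt}T_{\lambda(t),\gamma(t)}(x(t))+b(t)T_{\lambda(t),\gamma(t)}(x(t))=0,$$ where all data satisfy the standing assumptions listed in the context. Let $a,m,c:[t_0,+\infty)\to(0,+\infty)$ be continuous and differentiable functions such that (with $\mathcal W_v,\mathcal W_T$ defined in the context), for almost every $t\ge t_0$, - $m(t)\dot a(t)+a(t)\big(a(t)+\dot m(t)-m(t)\alpha(t)\big)+c(t)=0$; - $\mathcal W_v(t)>0$ and $\mathcal W_T(t)>0$; - $a(t)\dot a(t)+\tfrac12\dot c(t)\le 0$; and $\inf_{t\ge t_0}c(t)>0$. Suppose further that (asymptotic relations being for $t\to+\infty$) - $\sup_{t\ge t_0}a(t)<+\infty$ and $\sup_{t\ge t_0}\frac{m(t)\beta(t)}{\lambda(t)}<+\infty$; - there are constants $\underline m',\bar m'$ with $0<\underline m'\le\dot m(t)\le\bar m'$, and $m(t)\ge\dot m(t)$, $\inf_{t\ge t_0}\gamma(t)>0$; - $\frac{|\dot\gamma(t)|}{\gamma(t)}=\mathcal O\big(\frac{\dot m(t)}{m(t)}\big)$ and $\frac{|\dot\lambda(t)|}{\lambda(t)}=\mathcal O\big(\frac{\dot m(t)}{m(t)}\big)$; - for some constants $C_b,C_\lambda,C_v,C_T>0$: $\alpha(t)=\mathcal O\big(\frac{\dot m(t)}{m(t)}\big)$, $\beta(t)=\mathcal O\big(\frac{m(t)}{\dot m(t)}\big)$,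 $b(t)=\mathcal O(1)$, $b^2(t)\le C_b\frac{\dot m(t)\mathcal W_T(t)}{m^3(t)}$, $\lambda(t)\ge C_\lambda m^2(t)$, $\mathcal W_v(t)\ge C_vm(t)\dot m(t)$, $\mathcal W_T(t)\ge C_Tm^2(t)\dot m(t)$; - $\liminf_{t\to+\infty}\frac{m(t)\mathcal W_T(t)}{\dot m(t)\lambda^2(t)}>0$; - $\lim_{t\to+\infty}\big(a^2(t)+c(t)\big)=\ell$ for some $\ell>0$, and $\dot\beta(t)-b(t)=\mathcal O\big(\frac{\lambda(t)\dot m(t)}{m^2(t)}\big)$. Then: (i) for every $\bar x\in\operatorname{zer}(A+B)$, the limit $\lim_{t\to+\infty}\|x(t)-\bar x\|$ exists; (ii) $x(t)$ converges weakly, as $t\to+\infty$, to an element of $\operatorname{zer}(A+B)$.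
   Context: $\mathcal H$ is a real Hilbert space with inner product $\langle\cdot,\cdot\rangle$ and norm $\|\cdot\|$; $t_0\in\mathbb R$ is a fixed initial time. A set-valued operator $A:\mathcal H\to2^{\mathcal H}$ is $\rho$-comonotone ($\rho\in\mathbb R$) if $\langle x-y,u-v\rangle\ge\rho\|u-v\|^2$ for all $(x,u),(y,v)$ in its graph; it is maximal $\rho$-comonotone if moreover no $\rho$-comonotone operator has a graph properly containing that of $A$. A map $B:\mathcal H\to\mathcal H$ is $\nu$-cocoercive if $\langle Bx-By,x-y\rangle\ge\nu\|Bx-By\|^2$ for all $x,y$. $\operatorname{zer}(A+B)=\{x:0\in(A+B)(x)\}$. Resolvent: $J_{\gamma A}=(\operatorname{Id}+\gamma A)^{-1}$. Splitting operator: $T_{\lambda,\gamma}=\frac1\lambda\big(\operatorname{Id}-J_{\gamma A}\circ(\operatorname{Id}-\gamma B)\big)$. Standing assumptions: - $A$ is maximal $\rho$-comonotone, $B$ is $\nu$-cocoercive with $\nu>0$; $\lambda,\gamma,\delta,\theta,\phi,\psi:[t_0,+\infty)\to\mathbb R$ are continuously differentiable with $\lambda(t)>0$, $\delta(t)>0$, $\theta(t)\in[0,1]$, $\phi(t)\ge0$, $\psi(t)\ge0$, $\gamma(t)\in[\underline\gamma,\bar\gamma]\subset(\max\{0,-2\rho\},2\nu)$ for all $t\ge t_0$; and $\inf_{t\ge t_0}\Lambda(t)>0$, where $\Lambda(t)=\lambda(t)\frac{4\nu(\rho+\gamma(t))-\gamma^2(t)}{4\gamma(t)(\nu+\rho)}$.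 - $\operatorname{zer}(A+B)\ne\emptyset$. - With $\Gamma(t)=\theta(t)\phi(t)+(1-\theta(t))\psi(t)<1$, the coefficients are $$\alpha=\frac{\delta-\dot\Gamma}{1-\Gamma}-\frac{\dot\delta}{\delta},\qquad \beta=\frac{\lambda\theta}{1-\Gamma},\qquad b=\frac{\frac{d}{dt}(\lambda\theta)-\lambda\theta\,\frac{\dot\delta}{\delta}}{1-\Gamma},$$ and they satisfy $\alpha(t)>0$, $b(t)\ge0$, $\beta(t)>0$ for all $t\ge t_0$; $\alpha,b$ are locally integrable and $\beta$ is locally absolutely continuous. A strong global solution of the system is a function $x:[t_0,+\infty)\to\mathcal H$ such that $x,\dot x$ are continuous and absolutely continuous on each bounded interval $[t_0,T]$ and the equation holds for almost every $t\ge t_0$. Here $\frac{d}{dt}T_{\lambda(t),\gamma(t)}(x(t))$ is the derivative of $t\mapsto T_{\lambda(t),\gamma(t)}(x(t))$. Auxiliary functions (given $a,m,c$): $\mathcal K(t)=b(t)-\dot\beta(t)-\alpha(t)\beta(t)$; $\mathcal Q_1(t)=a(t)\big(a(t)\beta(t)+m(t)\mathcal K(t)\big)+c(t)\beta(t)$; $\mathcal Q_2(t)=m(t)\big(a(t)\beta(t)+m(t)\mathcal K(t)\big)$; $\mathcal W_v(t)=-m(t)\big(a(t)+\dot m(t)-m(t)\alpha(t)\big)$; $\mathcal W_T(t)=\mathcal Q_1(t)\Lambda(t)-\frac{\mathcal Q_2^2(t)}{2\mathcal W_v(t)}$. *)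

(* Defs.v *)
From HB Require Import structures.
From mathcomp Require Import all_boot all_order all_algebra sesquilinear.
From mathcomp Require Import all_classical all_reals all_analysis.

Set Implicit Arguments.
Unset Strict Implicit.
Unset Printing Implicit Defensive.

Import Order.TTheory GRing.Theory Num.Theory.
Import numFieldNormedType.Exports.

Local Open Scope classical_set_scope.
Local Open Scope ring_scope.

(* Functions on [t0, +oo[ are encoded as total functions on R of which only
   the values on [t0, +oo[ matter: every notion below is relative to
   [t0, +oo[. In particular the derivative at t0 is the right derivative,
   while for t > t0 it is the usual two-sided one. *)
Section half_line.
Context {R : realType} {V : normedModType R}.

Definition hl_is_derive (t0 : R) (f : R -> V) (t : R) (l : V) : Prop :=
  (s - t)^-1 *: (f s - f t) @[s --> within `[t0, +oo[ t^'] --> l.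

Definition hl_derivable (t0 : R) (f : R -> V) (t : R) : Prop := exists l, hl_is_derive t0 f t l.

Definition hl_deriv (t0 : R) (f : R -> V) (t : R) : V :=
  lim ((s - t)^-1 *: (f s - f t) @[s --> within `[t0, +oo[ t^']).

Definition hl_C1 (t0 : R) (f : R -> V) : Prop :=
  (forall t, t0 <= t -> hl_derivable t0 f t) /\
  {within `[t0, +oo[, continuous (hl_deriv t0 f)}.

Definition abs_continuous (x y : R) (f : R -> V) : Prop :=
  forall e, 0 < e -> exists2 d, 0 < d &
    forall (n : nat) (l r : 'I_n -> R),
      (forall i, x <= l i <= r i /\ r i <= y) ->
      (forall i j, i != j -> `]l i, r i[ `&` `]l j, r j[ = set0) ->
      \sum_(i < n) (r i - l i) < d ->
      \sum_(i < n) `|f (r i) - f (l i)| < e.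

Definition locally_abs_continuous (t0 : R) (f : R -> V) : Prop :=
  forall T, abs_continuous t0 T f.

End half_line.

(* The filter of neighbourhoods of +oo, packaged as the Landau notations
   require. *)
Definition at_pinfty (R : realType) : filter_on R :=
  FilterType (pinfty_nbhs R) _.

Definition hl_locally_integrable {R : realType} (t0 : R) (f : R -> R) : Prop :=
  forall T : R, lebesgue_measure.-integrable `[t0, T] (EFin \o f).

Definition induces_norm {R : realType} {H : normedModType R}
    (ip : H -> H -> R) : Prop :=
  forall u, ip u u = `|u| ^+ 2.

(* Set-valued operators H -> 2^H are functions H -> set H. *)
Section operators.
Context {R : realType} {H : completeNormedModType R} (ip : H -> H -> R).
Implicit Types (A : H -> set H) (B : H -> H) (x y u v : H).

Definition comonotone (rho : R) A : Prop :=
  forall x y u v, A x u -> A y v ->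
    rho * `|u - v| ^+ 2 <= ip (x - y) (u - v).

Definition maximal_comonotone (rho : R) A : Prop :=
  comonotone rho A /\
  forall A', comonotone rho A' -> (forall x, A x `<=` A' x) -> A' = A.

Definition cocoercive (nu : R) B : Prop :=
  forall x y, nu * `|B x - B y| ^+ 2 <= ip (B x - B y) (x - y).

Definition op_add A B : H -> set H := fun x => [set u + B x | u in A x].

Definition zer A : set H := [set x | A x 0].

(* (Id + g A)^-1 as a set-valued operator *)
Definition resolvent (g : R) A : H -> set H :=
  fun y => [set x | exists2 u, A x u & x + g *: u = y].

(* The resolvent as a map H -> H: the element of [resolvent g A y] when that
   set is a singleton. If A is maximal rho-comonotone, g > 0 and g + rho > 0,
   it is always a singleton; otherwise the value may be arbitrary. *)
Definition J (g : R) A : H -> H := fun y => get (resolvent g A y).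

Definition Tsplit (l g : R) A B : H -> H :=
  fun x => l^-1 *: (x - J g A (x - g *: B x)).

Definition weak_cvg (f : R -> H) (l : H) : Prop :=
  forall y, ip (f t) y @[t --> +oo] --> ip l y.

End operators.

Record params (R : realType) := Params {
  lambda : R -> R; gamma : R -> R; delta : R -> R;
  theta : R -> R; phi : R -> R; psi : R -> R }.

Section coefficients.
Context {R : realType} (t0 rho nu : R) (p : params R).
Local Notation D f := (hl_deriv t0 f).

Definition Gam (t : R) : R :=
  theta p t * phi p t + (1 - theta p t) * psi p t.

Definition Lam (t : R) : R :=
  lambda p t * ((4 * nu * (rho + gamma p t) - gamma p t ^+ 2)
                / (4 * gamma p t * (nu + rho))).

Definition alpha (t : R) : R :=
  (delta p t - D Gam t) / (1 - Gam t) - D (delta p) t / delta p t.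

Definition beta (t : R) : R := lambda p t * theta p t / (1 - Gam t).

Definition bcoef (t : R) : R :=
  (D (fun s => lambda p s * theta p s) t
   - lambda p t * theta p t * (D (delta p) t / delta p t)) / (1 - Gam t).

Context (a m c : R -> R).

Definition Kcal (t : R) : R := bcoef t - D beta t - alpha t * beta t.

Definition Q1 (t : R) : R :=
  a t * (a t * beta t + m t * Kcal t) + c t * beta t.

Definition Q2 (t : R) : R := m t * (a t * beta t + m t * Kcal t).

Definition Wv (t : R) : R := - m t * (a t + D m t - m t * alpha t).

Definition WT (t : R) : R := Q1 t * Lam t - Q2 t ^+ 2 / (2 * Wv t).

End coefficients.

Section assumptions.
Context {R : realType} {H : completeNormedModType R} (ip : H -> H -> R).
Context (t0 rho nu : R) (A : H -> set H) (B : H -> H) (p : params R).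
Local Notation D f := (hl_deriv t0 f).
Local Notation halfline := `[t0, +oo[%classic.

Record standing_assumptions : Prop := {
  sa_A : maximal_comonotone ip rho A;
  sa_nu : 0 < nu;
  sa_B : cocoercive ip nu B;
  sa_C1 : [/\ hl_C1 t0 (lambda p), hl_C1 t0 (gamma p) & hl_C1 t0 (delta p)]
       /\ [/\ hl_C1 t0 (theta p), hl_C1 t0 (phi p) & hl_C1 t0 (psi p)];
  sa_lambda : forall t, t0 <= t -> 0 < lambda p t;
  sa_delta : forall t, t0 <= t -> 0 < delta p t;
  sa_theta : forall t, t0 <= t -> 0 <= theta p t <= 1;
  sa_phi : forall t, t0 <= t -> 0 <= phi p t;
  sa_psi : forall t, t0 <= t -> 0 <= psi p t;
  sa_gamma : exists lo hi : R,
    [/\ Num.max 0 (- 2 * rho) < lo, hi < 2 * nu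
      & forall t, t0 <= t -> lo <= gamma p t <= hi];
  (* [inf] is 0 on sets without lower bound, so this also says that Lam is
     bounded below *)
  sa_Lam : 0 < inf (Lam rho nu p @` halfline);
  sa_zer : zer (op_add A B) !=set0;
  sa_Gam : forall t, t0 <= t -> Gam p t < 1;
  sa_alpha : forall t, t0 <= t -> 0 < alpha t0 p t;
  sa_b : forall t, t0 <= t -> 0 <= bcoef t0 p t;
  sa_beta : forall t, t0 <= t -> 0 < beta p t;
  sa_alpha_int : hl_locally_integrable t0 (alpha t0 p);
  sa_b_int : hl_locally_integrable t0 (bcoef t0 p);
  sa_beta_ac : locally_abs_continuous t0 (beta p : R -> R^o) }.

Definition Tflow (x : R -> H) : R -> H :=
  fun t => Tsplit (lambda p t) (gamma p t) A B (x t).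

Record strong_solution (x : R -> H) : Prop := {
  sol_C1 : hl_C1 t0 x;
  sol_ac : locally_abs_continuous t0 x;
  sol_ac_deriv : locally_abs_continuous t0 (hl_deriv t0 x);
  sol_eq : {ae lebesgue_measure, forall t, t0 <= t ->
    exists x2 dT : H,
      [/\ hl_is_derive t0 (hl_deriv t0 x) t x2,
          hl_is_derive t0 (Tflow x) t dT
        & x2 + alpha t0 p t *: hl_deriv t0 x t + beta p t *: dT
          + bcoef t0 p t *: Tflow x t = 0]} }.

Context (a m c : R -> R).
Local Notation WV := (Wv t0 p a m).
Local Notation WTT := (WT t0 rho nu p a m c).
Local Notation infty := (at_pinfty R).

Record lyapunov_conditions : Prop := {
  ly_pos : forall t, t0 <= t -> [/\ 0 < a t, 0 < m t & 0 < c t];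
  ly_cont : [/\ {within halfline, continuous a},
                {within halfline, continuous m}
              & {within halfline, continuous c}];
  ly_derivable : forall t, t0 <= t ->
    [/\ hl_derivable t0 (a : R -> R^o) t,
        hl_derivable t0 (m : R -> R^o) t
      & hl_derivable t0 (c : R -> R^o) t];
  ly_eq : {ae lebesgue_measure, forall t, t0 <= t ->
    m t * D a t + a t * (a t + D m t - m t * alpha t0 p t) + c t = 0};
  ly_W : {ae lebesgue_measure, forall t, t0 <= t -> 0 < WV t /\ 0 < WTT t};
  ly_le : {ae lebesgue_measure, forall t, t0 <= t ->
    a t * D a t + 2^-1 * D c t <= 0};
  ly_inf_c : 0 < inf (c @` halfline) }.

Record growth_conditions : Prop := {
  gr_a : has_ubound (a @` halfline);
  gr_mbeta : has_ubound ((fun t => m t * beta p t / lambda p t) @` halfline);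
  gr_dm : exists lo hi : R,
    0 < lo /\ forall t, t0 <= t -> lo <= D m t <= hi;
  gr_m : forall t, t0 <= t -> D m t <= m t;
  gr_gamma : 0 < inf (gamma p @` halfline);
  gr_dgamma : (fun t => `|D (gamma p) t| / gamma p t : R^o)
                =O_infty (fun t => D m t / m t : R^o);
  gr_dlambda : (fun t => `|D (lambda p) t| / lambda p t : R^o)
                =O_infty (fun t => D m t / m t : R^o);
  gr_alpha : (alpha t0 p : R -> R^o)
                =O_infty (fun t => D m t / m t : R^o);
  gr_beta : (beta p : R -> R^o)
                =O_infty (fun t => m t / D m t : R^o);
  gr_b : (bcoef t0 p : R -> R^o) =O_infty (fun=> 1 : R^o);
  gr_b2 : exists2 Cb, 0 < Cb & forall t, t0 <= t ->
    bcoef t0 p t ^+ 2 <= Cb * (D m t * WTT t / m t ^+ 3);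
  gr_lambda : exists2 Cl, 0 < Cl & forall t, t0 <= t ->
    Cl * m t ^+ 2 <= lambda p t;
  gr_Wv : exists2 Cv, 0 < Cv & forall t, t0 <= t ->
    Cv * (m t * D m t) <= WV t;
  gr_WT : exists2 CT, 0 < CT & forall t, t0 <= t ->
    CT * (m t ^+ 2 * D m t) <= WTT t;
  gr_liminf : (0 < limf_einf
    (fun t => (m t * WTT t / (D m t * lambda p t ^+ 2))%:E)
    (pinfty_nbhs R))%E;
  gr_lim : exists2 ell : R, 0 < ell & a t ^+ 2 + c t @[t --> +oo] --> ell;
  gr_dbeta : (fun t => D (beta p) t - bcoef t0 p t : R^o)
    =O_infty (fun t => lambda p t * D m t / m t ^+ 2 : R^o) }.

End assumptions.

(* Main.v *)
(** With [y = x' + beta T] the equation becomes first order,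
    [y' = (alpha beta - b + beta') T - alpha y], and along [z] in [zer (A + B)]
    the energy [(|a (x - z) + m y|^2 + c |x - z|^2) / 2] satisfies, almost
    everywhere, [E' <= - Wv |y|^2 / 2 - WT |T|^2], because [T] is
    [Lambda]-cocoercive. The growth conditions turn this into
    [E' <= - kappa (|m y|^2 + |lambda T|^2) / m]. Both [m y] and [lambda T]
    are Lipschitz in the time scale [ln m], so they tend to 0; then
    [(a^2 + c) |x - z|^2 / 2] has the same limit as the energy, which gives (i).
    Since [lambda T] is the residual of the forward-backward map, weak cluster
    points of [x] are zeros of [A + B] and Opial's argument gives (ii).

    The weights [a], [m], [c] are differentiable everywhere but need not be
    absolutely continuous, so monotonicity of the energy rests on a criterion
    that covers derivatives existing almost everywhere for functions whose
    increments are, at every point, controlled by those of an absolutely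
    continuous one. *)

Require Import Defs.
From HB Require Import structures.
From mathcomp Require Import all_boot all_order all_algebra sesquilinear.
From mathcomp Require Import ring lra.
From mathcomp Require Import all_classical all_reals all_analysis measurable_realfun.

Set Implicit Arguments.
Unset Strict Implicit.
Unset Printing Implicit Defensive.

Import Order.TTheory GRing.Theory Num.Theory.
Import numFieldNormedType.Exports.

Local Open Scope classical_set_scope.
Local Open Scope ring_scope.

(** * Hilbert space *)

(** [A] is maximal only in the graph sense and [rho] may be negative, so the surjectivity of
    [Id + gamma A] is itself a theorem: it is Minty's theorem for the inverse of [A] shifted by
    [rho]. One minimization lemma yields both Minty's theorem, through the Fitzpatrick function, and
    the Riesz representation that supplies weak limits.

    The unknown [y] is chosen because the derivative of [T] exists only almost everywhere; it
    cancels in [y'] and never has to be estimated.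

    The derivatives of [a], [m], [c] may fail to be integrable, so the dissipation is never
    integrated. Every estimate is a mean value inequality between two times, and the decay of [m y]
    and [lambda T] comes from a fixed loss of energy over windows of length proportional to [m t].
    Weak compactness is used along ultrafilters finer than [+oo], which asks for no separability and
    reduces Opial's argument to the uniqueness of limits. *)

Section inner_product.
Context {R : realType} {H : completeNormedModType R}.
Context (ip : {dot H for idfun}) (ip_norm : induces_norm ip).
Implicit Types u v w : H.

Lemma ipC u v : ip u v = ip v u.
Proof. by rewrite hermC /= expr0 mul1r. Qed.

Lemma ipDl u v w : ip (u + v) w = ip u w + ip v w.
Proof. exact: linearDl. Qed.

Lemma ipZl k u w : ip (k *: u) w = k * ip u w.
Proof. exact: linearZl_LR. Qed.

Lemma ipNl u w : ip (- u) w = - ip u w.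
Proof. exact: linearNl. Qed.

Lemma ip0l w : ip 0 w = 0.
Proof. exact: linear0l. Qed.

Lemma ipBl u v w : ip (u - v) w = ip u w - ip v w.
Proof. by rewrite ipDl ipNl. Qed.

Lemma ipDr u v w : ip w (u + v) = ip w u + ip w v.
Proof. by rewrite ipC ipDl !(ipC w). Qed.

Lemma ipZr k u w : ip w (k *: u) = k * ip w u.
Proof. by rewrite ipC ipZl ipC. Qed.

Lemma ipNr u w : ip w (- u) = - ip w u.
Proof. by rewrite ipC ipNl ipC. Qed.

Lemma ipBr u v w : ip w (u - v) = ip w u - ip w v.
Proof. by rewrite ipDr ipNr. Qed.

Lemma ip0r w : ip w 0 = 0.
Proof. by rewrite ipC ip0l. Qed.

Definition ipE := (ipDl, ipDr, ipBl, ipBr, ipNl, ipNr, ipZl, ipZr, ip0l, ip0r).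

Lemma ip_ge0 u : 0 <= ip u u.
Proof. by rewrite ip_norm sqr_ge0. Qed.

Lemma ip_eq0 u : ip u u <= 0 -> u = 0.
Proof.
rewrite ip_norm => h; apply/eqP; rewrite -normr_eq0 -sqrf_eq0.
by rewrite eq_le h sqr_ge0.
Qed.

Lemma ip_CauchySchwarz u v : `|ip u v| <= `|u| * `|v|.
Proof.
have [->|u0] := eqVneq u 0; first by rewrite ip0l !normr0 mul0r.
have U0 : 0 < `|u| by rewrite normr_gt0.
have := ip_ge0 (ip u u *: v - ip u v *: u).
rewrite !ipE (ipC v u) !ip_norm => h.
rewrite -ler_sqr ?nnegrE ?mulr_ge0// real_normK ?num_real// exprMn.
have : 0 <= `|u| ^+ 2 * (`|u| ^+ 2 * `|v| ^+ 2 - ip u v ^+ 2).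
  by apply: le_trans h _; rewrite le_eqVlt; apply/orP; left; apply/eqP; ring.
by rewrite pmulr_rge0 ?exprn_gt0// subr_ge0.
Qed.

Lemma ip_le u v : ip u v <= `|u| * `|v|.
Proof. exact: le_trans (ler_norm _) (ip_CauchySchwarz u v). Qed.

Lemma sqr_norm_le u v : ip u u <= ip v v -> `|u| <= `|v|.
Proof. by rewrite !ip_norm ler_sqr ?nnegrE. Qed.

End inner_product.

(** * Minimization of strongly convex functionals *)

Section strongly_convex.
Context {R : realType} {H : completeNormedModType R}.
Context (ip : {dot H for idfun}) (ip_norm : induces_norm ip).
Implicit Types u v w x y z : H.

Lemma cauchy_seq_cvg (z : nat -> H) :
  (forall e : R, 0 < e -> exists N, forall n, (N <= n)%N -> `|z N - z n| < e) ->
  cvgn z.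
Proof.
move=> h; apply: cauchy_cvg; apply: cauchy_exP => e e0.
have [N hN] := h _ e0; exists (z N); exists N => //= n /= Nn.
by rewrite -ball_normE /=; exact: hN.
Qed.

(* By the midpoint inequality, every minimizing sequence is Cauchy. *)
Lemma strongly_convex_min (C : H -> H -> R -> Prop) (lb : R) :
  (exists x u r, C x u r) ->
  (forall x u r, C x u r -> lb <= r + (ip x x + ip u u) / 2) ->
  (forall (s : R) x u r x' u' r', 0 <= s <= 1 -> C x u r -> C x' u' r' ->
     C (x + s *: (x' - x)) (u + s *: (u' - u)) (r + s * (r' - r))) ->
  (forall x u r, (forall e : R, 0 < e -> exists x' u' r',
     [/\ C x' u' r', `|x - x'| < e, `|u - u'| < e & `|r - r'| < e]) ->
     C x u r) ->
  exists x0 u0 r0, C x0 u0 r0 /\ forall x u r, C x u r ->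
    r0 + (ip x0 x0 + ip u0 u0) / 2
      + (ip (x - x0) (x - x0) + ip (u - u0) (u - u0)) / 2
    <= r + (ip x x + ip u u) / 2.
Proof.
move=> [xa [ua [ra Ca]]] hlb hconv hclosed.
pose phi x u r : R := r + (ip x x + ip u u) / 2.
pose S := [set s | exists x u r, C x u r /\ s = phi x u r].
have hasI : has_inf S.
  split; first by exists (phi xa ua ra), xa, ua, ra.
  by exists lb => _ [x [u [r [Cx ->]]]]; exact: hlb.
pose I := inf S.
have leI x u r : C x u r -> I <= phi x u r.
  by move=> Cx; apply: ge_inf; [case: hasI|exists x, u, r].
have /choice [z hz] (n : nat) : exists z : H * H * R,
    C z.1.1 z.1.2 z.2 /\ phi z.1.1 z.1.2 z.2 < I + n.+1%:R^-1.
  have [_ [x [u [r [Cx ->]]]] hI] := @inf_adherent _ S n.+1%:R^-1 ltac:(by rewrite invr_gt0) hasI.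
  by exists (x, u, r).
clearbody I; clear S hasI hlb.
have half01 : 0 <= (2^-1 : R) <= 1.
  by rewrite invr_ge0 ler0n /= invf_le1 ?ler1n.
have par n m : ip (z n).1.1 (z n).1.1 + ip (z m).1.1 (z m).1.1
    - 2 * ip (z n).1.1 (z m).1.1 + (ip (z n).1.2 (z n).1.2
    + ip (z m).1.2 (z m).1.2 - 2 * ip (z n).1.2 (z m).1.2)
    <= 4 * (n.+1%:R^-1 + m.+1%:R^-1).
  have [Cn hn] := hz n; have [Cm hm] := hz m.
  have := leI _ _ _ (hconv _ _ _ _ _ _ _ half01 Cn Cm).
  move: hn hm; rewrite /phi !ipE.
  rewrite (ipC ip (z m).1.1 (z n).1.1) (ipC ip (z m).1.2 (z n).1.2).
  by move: (n.+1%:R^-1) (m.+1%:R^-1) => p q; lra.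
have dist n m : `|(z n).1.1 - (z m).1.1| ^+ 2 + `|(z n).1.2 - (z m).1.2| ^+ 2
    <= 4 * (n.+1%:R^-1 + m.+1%:R^-1).
  rewrite -!ip_norm !ipE (ipC ip (z m).1.1 (z n).1.1) (ipC ip (z m).1.2 (z n).1.2).
  by have := par n m; move: (n.+1%:R^-1) (m.+1%:R^-1) => p q; lra.
have small (e : R) : 0 < e -> exists N, forall n, (N <= n)%N ->
    4 * (N.+1%:R^-1 + n.+1%:R^-1) < e ^+ 2.
  move=> e0; have e2 : 0 < e ^+ 2 / 8 by rewrite divr_gt0 ?exprn_gt0.
  have [N hN] := ltr_add_invr (y := 0 : R) (x := e ^+ 2 / 8) ltac:(by rewrite e2).
  exists N => n Nn.
  have : (n.+1%:R^-1 : R) <= N.+1%:R^-1 by rewrite lef_pV2 ?posrE ?ltr0n// ler_nat.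
  by move: hN; rewrite add0r; move: (N.+1%:R^-1) (n.+1%:R^-1) => p q; lra.
have cx : cvgn (fun n => (z n).1.1).
  apply: cauchy_seq_cvg => e e0; have [N hN] := small _ e0; exists N => n Nn.
  rewrite -(@ltr_pXn2r _ 2) ?nnegrE ?(ltW e0)//.
  have := dist N n; have := hN _ Nn; move: (_ * (_ + _)) => s.
  have := sqr_ge0 `|(z N).1.2 - (z n).1.2|; lra.
have cu : cvgn (fun n => (z n).1.2).
  apply: cauchy_seq_cvg => e e0; have [N hN] := small _ e0; exists N => n Nn.
  rewrite -(@ltr_pXn2r _ 2) ?nnegrE ?(ltW e0)//.
  have := dist N n; have := hN _ Nn; move: (_ * (_ + _)) => s.
  have := sqr_ge0 `|(z N).1.1 - (z n).1.1|; lra.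
set x0 := limn (fun n => (z n).1.1) in cx; set u0 := limn (fun n => (z n).1.2) in cu.
(* The [r] coordinates need no Cauchy estimate: the values of the functional tend to [I], which
   forces their limit. *)
pose r0 := I - (ip x0 x0 + ip u0 u0) / 2.
have cr : (z n).2 @[n --> \oo] --> r0.
  have cphi : phi (z n).1.1 (z n).1.2 (z n).2 @[n --> \oo] --> I.
    apply: (@squeeze_cvgr _ _ _ _ (fun=> I) (fun n => I + n.+1%:R^-1)).
    - near=> n; have [Cn hn] := hz n; rewrite (ltW hn) andbT; exact: leI.
    - exact: cvg_cst.
    - by rewrite -[X in _ --> X]addr0; apply: cvgD; [exact: cvg_cst|exact: cvg_harmonic].
  have -> : (fun n => (z n).2) = (fun n => phi (z n).1.1 (z n).1.2 (z n).2
       - (`|(z n).1.1| ^+ 2 + `|(z n).1.2| ^+ 2) / 2).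
    by apply/funext => n; rewrite /phi !ip_norm; ring.
  rewrite /r0 !ip_norm; apply: cvgB => //; apply: cvgMl.
  by apply: cvgD; rewrite !expr2; apply: cvgM; apply: cvg_norm.
have C0 : C x0 u0 r0.
  apply: hclosed => e e0.
  have : \forall n \near \oo, [/\ `|x0 - (z n).1.1| < e, `|u0 - (z n).1.2| < e
       & `|r0 - (z n).2| < e].
    near=> n; split; near: n.
    - by move/cvgrPdist_lt : cx => /(_ _ e0).
    - by move/cvgrPdist_lt : cu => /(_ _ e0).
    - by move/cvgrPdist_lt : cr => /(_ _ e0).
  move=> /filter_ex [n [h1 h2 h3]]; exists (z n).1.1, (z n).1.2, (z n).2.
  by split=> //; case: (hz n).
exists x0, u0, r0; split => // x u r Cx.
have E0 : phi x0 u0 r0 = I by rewrite /phi /r0; ring.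
rewrite -/(phi x0 u0 r0) -/(phi x u r) E0.
set D := _ / 2.
have Dge0 : 0 <= D by rewrite /D divr_ge0// addr_ge0 ?(ip_ge0 ip_norm).
(* Minimality tested a fraction [s] of the way to [(x, u, r)] and divided by [s]; the loss [s * D]
   vanishes with [s]. *)
have key (s : R) : 0 < s -> s <= 1 -> I + (1 - s) * D <= phi x u r.
  move=> s0 s1.
  have := leI _ _ _ (hconv _ _ _ _ _ _ _ (introT andP (conj (ltW s0) s1)) C0 Cx).
  rewrite -E0 /phi /D !ipE (ipC ip x x0) (ipC ip u u0) => h.
  rewrite -(ler_pM2l s0); nra.
apply/ler_addgt0Pr => e e0.
have D1 : 0 < D + 1 by lra.
pose s := Num.min 1 (e / (D + 1)).
have s0 : 0 < s by rewrite lt_min ltr01 divr_gt0.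
have := key s s0 ltac:(by rewrite ge_min lexx).
have : s * (D + 1) <= e by rewrite -ler_pdivlMr// ge_min lexx orbT.
by nra.
Unshelve. all: by end_near. Qed.

End strongly_convex.

(** * Minty's theorem and Riesz representation *)

Section maximal_monotone.
Context {R : realType} {H : completeNormedModType R}.
Context (ip : {dot H for idfun}) (ip_norm : induces_norm ip).
Implicit Types u v w x y z : H.
(** Minimizing the Fitzpatrick function plus [(|x|^2 + |u|^2) / 2] produces a pair [(- u0, - x0)]
    that is monotonically related to the whole graph, with excess [|x0 + u0|^2]. Maximality puts
    this pair in [G], and testing it against itself gives [x0 = - u0]. *)
Lemma minty (G : H -> H -> Prop) :
  (forall x u y v, G x u -> G y v -> 0 <= ip (x - y) (u - v)) ->
  (forall x u, (forall y v, G y v -> 0 <= ip (x - y) (u - v)) -> G x u) ->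
  exists x, G x (- x).
Proof.
move=> Gmono Gmax.
(* the epigraph of the Fitzpatrick function of [G] *)
pose C x u (r : R) := forall y v, G y v -> ip x v + ip y u - ip y v <= r.
(* The Fitzpatrick function is at least the duality product: a pair where it were smaller would be
   related to all of [G], hence belong to [G], and then the supremum would include [ip x u]
   itself. *)
have Cip x u r : C x u r -> ip x u <= r.
  move=> Cxu; rewrite leNgt; apply/negP => rlt.
  have /Cxu : G x u.
    by apply: Gmax => y v /Cxu; rewrite !ipE; lra.
  lra.
(* An empty [G] would contain [(0, 0)], every pair being vacuously related to it. *)
have [y0 [v0 G0]] : exists y v, G y v.
  apply: contrapT => nG; apply: (nG); exists 0, 0; apply: Gmax => y v Gyv.
  by exfalso; apply: nG; exists y, v.
have [||||x0 [u0 [r0 [C0 hmin]]]] := strongly_convex_min ip_norm (C := C) (lb := 0).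
- exists y0, v0, (ip y0 v0) => y v Gyv.
  by have := Gmono _ _ _ _ G0 Gyv; rewrite !ipE; lra.
- move=> x u r /Cip hr; have := ip_ge0 ip_norm (x + u).
  by rewrite !ipE (ipC ip u x); lra.
- move=> s x u r x' u' r' /andP[s0 s1] Cx Cx' y v Gyv.
  have := Cx _ _ Gyv; have := Cx' _ _ Gyv; rewrite !ipE; nra.
- move=> x u r hcl y v Gyv; apply/ler_addgt0Pr => e e0.
  pose K := `|v| + `|y| + 1.
  have K0 : 0 < K by rewrite /K ltr_wpDl// addr_ge0.
  have [x' [u' [r' [C' hx hu hr]]]] := hcl (e / K) (divr_gt0 e0 K0).
  have := C' _ _ Gyv.
  have := ip_le ip_norm (x - x') v; have := ip_le ip_norm y (u - u').
  have : e / K * K = e by rewrite divfK// gt_eqF.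
  move: hx hu hr; rewrite ltr_distl => hx hu /andP[hr _] hK.
  rewrite !ipE => h1 h2 h3.
  have : `|y| * `|u - u'| <= `|y| * (e / K) by rewrite ler_wpM2l// ltW.
  have : `|x - x'| * `|v| <= e / K * `|v| by rewrite ler_wpM2r// ltW.
  move: (e / K) hK hr => d; rewrite /K => hK hr.
  lra.
(* By monotonicity graph points lie in the epigraph at height [ip y v], so they compete with the
   minimizer; its quadratic growth supplies the square. *)
have related : forall y v, G y v -> ip (x0 + u0) (x0 + u0) <= ip (- u0 - y) (- x0 - v).
  move=> y v Gyv.
  have Cyv : C y v (ip y v).
    by move=> y' v' /(Gmono _ _ _ _ Gyv); rewrite !ipE; lra.
  have := hmin _ _ _ Cyv; have := Cip _ _ _ C0.
  rewrite !ipE (ipC ip v u0) (ipC ip u0 x0) (ipC ip y x0); lra.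
have Gux : G (- u0) (- x0).
  by apply: Gmax => y v /related; apply: le_trans; exact: ip_ge0 ip_norm _.
exists (- u0); rewrite opprK.
have := related _ _ Gux; rewrite !subrr ip0l => /(ip_eq0 ip_norm)/eqP.
by rewrite addr_eq0 => /eqP x0E; move: Gux; rewrite x0E opprK.
Qed.

(** The representing vector minimizes [|x|^2 / 2 - f x]. Quadratic growth at the minimizer cancels
    the term [|u|^2 / 2] created by a perturbation [u], so [f u <= ip x0 u] follows without a limit,
    and [- u] gives the converse. *)
Lemma riesz_representation (f : H -> R) (M : R) :
  (forall u v, f (u + v) = f u + f v) -> (forall k u, f (k *: u) = k * f u) ->
  (forall u, `|f u| <= M * `|u|) -> exists p, forall u, f u = ip p u.
Proof.
move=> fD fZ fM.
have f0 : f 0 = 0 by rewrite -(scale0r 0) fZ mul0r.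
have fB u v : f (u - v) = f u - f v by rewrite fD -scaleN1r fZ mulN1r.
have f_le u : f u <= M * `|u| by exact: le_trans (ler_norm _) (fM u).
pose C (x u : H) (r : R) := u = 0 /\ r = - f x.
have [||||x0 [u0 [r0 [[-> ->] hmin]]]] := strongly_convex_min ip_norm (C := C) (lb := - (M ^+ 2 / 2)).
- by exists 0, 0, 0; split=> //; rewrite f0 oppr0.
- move=> x _ _ [-> ->]; have := f_le x; have := sqr_ge0 (`|x| - M).
  by rewrite ip0l ip_norm; lra.
- move=> s x _ _ x' _ _ _ [-> ->] [-> ->]; split; first by rewrite subrr scaler0 addr0.
  by rewrite fD fZ fB; ring.
- move=> x u r hcl; split.
    apply/eqP; rewrite -normr_le0; apply/ler_addgt0Pr => e e0.
    by have [x' [_ [_ [[-> _] _ + _]]]] := hcl e e0; rewrite subr0 add0r => /ltW.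
  apply/eqP; rewrite -subr_eq0 opprK -normr_le0; apply/ler_addgt0Pr => e e0.
  have K0 : 0 < `|M| + 1 by rewrite ltr_wpDl.
  have [x' [_ [_ [[_ ->] hx _ hr]]]] := hcl (e / (`|M| + 1)) (divr_gt0 e0 K0).
  have -> : r + f x = (r - - f x') + f (x - x') by rewrite fB; ring.
  apply: le_trans (ler_normD _ _) _.
  have : e / (`|M| + 1) * (`|M| + 1) = e by rewrite divfK// gt_eqF.
  have := fM (x - x').
  have : M * `|x - x'| <= `|M| * (e / (`|M| + 1)).
    apply: (@le_trans _ _ (`|M| * `|x - x'|)); first by rewrite ler_wpM2r// ler_norm.
    by rewrite ler_wpM2l// ltW.
  by move: hr; move: (e / _) => d; lra.
have half u : f u <= ip x0 u.
  have := hmin (x0 + u) 0 _ (conj erefl erefl).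
  rewrite (addrC x0 u) addrK subrr !ip0l fD !ipE (ipC ip u x0); lra.
exists x0 => u; apply/eqP; rewrite eq_le half/=.
by have := half (- u); rewrite -scaleN1r fZ !mulN1r scaleN1r ipNr lerN2.
Qed.

End maximal_monotone.

(** * Surjectivity of [Id + g A] for maximal comonotone [A] *)

Section operators.
Context {R : realType} {H : completeNormedModType R}.
Context (ip : {dot H for idfun}) (ip_norm : induces_norm ip).
Implicit Types u v w x y z : H.
Implicit Types (A : H -> set H) (B : H -> H).

(** Comonotonicity of [A] says that its inverse minus [rho Id] is monotone. [G] is that operator
    with its argument scaled by [g + rho] and translated by [- y]; a pair [(p, - p)] in [G] is
    exactly a solution of [x + g u = y]. *)
Lemma resolvent_total (rho g : R) (A : H -> set H) (y : H) :
  maximal_comonotone ip rho A -> 0 < g + rho ->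
  exists x u, A x u /\ x + g *: u = y.
Proof.
move=> [Acom Amax] s0.
pose G p q := exists x u, [/\ A x u, p = (g + rho) *: u - y & q = x - rho *: u].
have [||p [x [u [Axu -> /eqP hx]]]] := minty ip_norm (G := G).
- move=> p q p' q' [x [u [Axu -> ->]]] [x' [u' [Axu' -> ->]]].
  have := Acom _ _ _ _ Axu Axu'; rewrite -ip_norm.
  rewrite (_ : (g + rho) *: u - y - _ = (g + rho) *: (u - u')); last first.
    by rewrite opprB addrA subrK scalerBr.
  rewrite (_ : x - rho *: u - _ = (x - x') - rho *: (u - u')); last first.
    by rewrite scalerBr !opprB addrACA [in RHS]addrC [RHS]addrACA; congr (_ + _);
       rewrite addrC.
  by move=> h; rewrite ipZl pmulr_rge0// ipBr ipZr (ipC ip (u - u') (x - x')) subr_ge0.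
- move=> p q hpq.
  pose u := (g + rho)^-1 *: (p + y); pose x := q + rho *: u.
  have pE : p = (g + rho) *: u - y.
    by rewrite /u scalerA divff ?gt_eqF// scale1r addrK.
  have qE : q = x - rho *: u by rewrite /x addrK.
  exists x, u; split=> //.
  have rel x' u' : A x' u' -> rho * `|u - u'| ^+ 2 <= ip (x - x') (u - u').
    move=> Axu'.
    have := hpq _ _ (ex_intro _ x' (ex_intro _ u' (And3 Axu' erefl erefl))).
    rewrite -ip_norm {1}pE {1}qE.
    rewrite (_ : (g + rho) *: u - y - _ = (g + rho) *: (u - u')); last first.
      by rewrite opprB addrA subrK scalerBr.
    rewrite (_ : x - rho *: u - _ = (x - x') - rho *: (u - u')); last first.
      by rewrite scalerBr !opprB addrACA [in RHS]addrC [RHS]addrACA; congr (_ + _);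
         rewrite addrC.
    by rewrite ipZl pmulr_rge0// ipBr ipZr (ipC ip (u - u') (x - x')) subr_ge0.
  (* Graph maximality is exploited by adjoining the single pair [(x, u)]. *)
  pose A' z : set H := [set w | A z w \/ (z = x /\ w = u)].
  have A'A : A' = A.
    apply: Amax => [z z' w w' [Azw|[-> ->]] [Azw'|[-> ->]]|z w Azw]; last by left.
    + exact: Acom.
    + have := rel _ _ Azw; rewrite distrC => h; apply: le_trans h _.
      by rewrite -(opprB w) -(opprB z) ipNl ipNr opprK.
    + exact: rel.
    + by rewrite !subrr ip0l normr0 expr0n/= mulr0.
  by rewrite -A'A; right.
exists x, u; split=> //.
move: hx; rewrite eq_sym subr_eq => /eqP ->.
by rewrite opprB -addrA -scalerDl [rho + g]addrC subrK.
Qed.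
End operators.

(** * The forward-backward residual *)

Section forward_backward.
Context {R : realType} {H : completeNormedModType R}.
Context (ip : {dot H for idfun}) (ip_norm : induces_norm ip).
Implicit Types u v w x y z : H.
Implicit Types (A : H -> set H) (B : H -> H).

Definition fb_residual (g : R) A B x : H := x - J g A (x - g *: B x).

(** [0 < g + 2 rho] makes the resolvent nonexpansive; together with [g < 2 nu] it gives
    [nu + rho > 0] and a residual whose cocoercivity constant exceeds [1/2]. *)
Definition admissible_step (rho nu g : R) : Prop :=
  [/\ 0 < g, 0 < g + 2 * rho & g < 2 * nu].

Lemma subrBB (x y z w : H) : (x - y) - (z - w) = (x - z) - (y - w).
Proof. by rewrite !opprB addrACA [RHS]addrACA (addrC (- y)). Qed.

Lemma resolvent_nonexpansive (rho g : R) A x u y v :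
  comonotone ip rho A -> 0 < g -> 0 < g + 2 * rho -> A x u -> A y v ->
  `|x - y| <= `|(x + g *: u) - (y + g *: v)|.
Proof.
move=> Acom g0 g1 Axu Ayv; apply: (sqr_norm_le ip_norm).
rewrite opprD addrACA -scalerBr.
have := Acom _ _ _ _ Axu Ayv; rewrite -ip_norm.
move: (x - y) (u - v) => p q; rewrite !ipE (ipC ip q p) => h.
have := mulr_ge0 (mulr_ge0 (ltW g0) (ltW g1)) (ip_ge0 ip_norm q); nra.
Qed.

Context (rho nu : R) (A : H -> set H) (B : H -> H).
Hypothesis Amax : maximal_comonotone ip rho A.
Hypothesis Bcoc : cocoercive ip nu B.
Local Notation S g := (fb_residual g A B).
Local Notation admissible := (admissible_step rho nu).

(** Trades the chosen value of [J] for a graph relation; surjectivity of [Id + g A] guarantees that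
    there is something to choose. *)
Lemma fb_residual_graph (g : R) x : admissible g ->
  A (x - S g x) (g^-1 *: S g x - B x).
Proof.
move=> [g0 g1 g2]; have gr : 0 < g + rho by lra.
have [p [u [Apu pE]]] := resolvent_total ip_norm (x - g *: B x) Amax gr.
have /getPex : exists p, resolvent g A (x - g *: B x) p by exists p, u.
rewrite -/(J g A (x - g *: B x)) => -[v Av vE].
rewrite /fb_residual subKr.
suff -> : g^-1 *: (x - J g A (x - g *: B x)) - B x = v by [].
have gN0 : g != 0 by rewrite gt_eqF.
apply: (scalerI gN0); rewrite scalerBr scalerA divff// scale1r addrAC.
by apply/eqP; rewrite subr_eq [X in _ == X]addrC vE.
Qed.

Lemma fb_residual_unique (g : R) x d : admissible g ->
  A (x - d) (g^-1 *: d - B x) -> S g x = d.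
Proof.
move=> adm Ad; have [g0 g1 g2] := adm.
have := fb_residual_graph x adm; move: (S g x) => s As.
have := resolvent_nonexpansive Amax.1 g0 g1 As Ad.
rewrite !scalerBr !scalerA divff ?gt_eqF// !scale1r !addrA !subrK subrr normr0.
rewrite normr_le0 subr_eq0 => /eqP h; apply: oppr_inj; exact: (addrI x).
Qed.

Lemma fb_residual_graph_le (g : R) x y : admissible g ->
  rho * `|(S g x - S g y) - g *: (B x - B y)| ^+ 2
  <= g * ip ((x - y) - (S g x - S g y)) ((S g x - S g y) - g *: (B x - B y)).
Proof.
move=> adm; have [g0 g1 g2] := adm.
have := Amax.1 _ _ _ _ (fb_residual_graph x adm) (fb_residual_graph y adm).
rewrite (subrBB x) (subrBB (_ *: _) (B x)) -scalerBr.
move: (x - y) (S g x - S g y) (B x - B y) => X D b.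
have -> : g^-1 *: D - b = g^-1 *: (D - g *: b).
  by rewrite scalerBr scalerA mulVf ?gt_eqF// scale1r.
have gN0 : g != 0 by rewrite gt_eqF.
move: (D - g *: b) => V; rewrite -!ip_norm ipZl !ipZr.
rewrite -(ler_pM2l (mulr_gt0 g0 g0)).
congr (_ <= _); field; exact: gN0.
Qed.

(** Adding [g^2] times the cocoercivity of [B] to the comonotonicity inequality cancels the product
    of [x - y] with [B x - B y]. A quadratic form in the increments of [S g] and [B] remains; up to
    the factor [g], its minimum over the increment of [B] is the constant. *)
Lemma fb_residual_cocoercive (g : R) x y : admissible g ->
  (4 * nu * (rho + g) - g ^+ 2) / (4 * g * (nu + rho))
    * `|S g x - S g y| ^+ 2 <= ip (x - y) (S g x - S g y).
Proof.
move=> adm; have [g0 g1 g2] := adm.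
have := fb_residual_graph_le x y adm; have := Bcoc x y.
rewrite -!ip_norm; move: (x - y) (S g x - S g y) (B x - B y) => X D b.
have nr : 0 < nu + rho by lra.
have d0 : 0 < 4 * g * (nu + rho) by rewrite !mulr_gt0.
rewrite mulrAC ler_pdivrMr//.
have := ip_ge0 ip_norm ((g + 2 * rho) *: D - (2 * g * (nu + rho)) *: b).
rewrite !ipE (ipC ip b D) (ipC ip b X) => h1 h2 h3.
have := ler_wpM2l (ltW (mulr_gt0 (mulr_gt0 g0 g0) nr)) h2.
have := ler_wpM2l (ltW nr) h3.
lra.
Qed.

(** The cocoercivity constant exceeds [1/2] by [(2 nu - g) (g + 2 rho) / (4 g (nu + rho))], so this
    form is uniform in [g]. *)
Lemma fb_residual_half_cocoercive (g : R) x y : admissible g ->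
  `|S g x - S g y| ^+ 2 <= 2 * ip (x - y) (S g x - S g y).
Proof.
move=> adm; have [g0 g1 g2] := adm.
have := fb_residual_cocoercive x y adm.
have nr : 0 < nu + rho by lra.
have d0 : 0 < 4 * g * (nu + rho) by rewrite !mulr_gt0.
have : 2^-1 <= (4 * nu * (rho + g) - g ^+ 2) / (4 * g * (nu + rho)).
  by rewrite ler_pdivlMr//; nra.
move=> h1 h2; have := ler_wpM2r (sqr_ge0 `|S g x - S g y|) h1; lra.
Qed.

Lemma fb_residual_lipschitz (g : R) x y : admissible g ->
  `|S g x - S g y| <= 2 * `|x - y|.
Proof.
move=> adm; have h := fb_residual_half_cocoercive x y adm.
have := ip_le ip_norm (x - y) (S g x - S g y).
have [->|n0] := eqVneq `|S g x - S g y| 0; first by rewrite mulr_ge0.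
have p0 : 0 < `|S g x - S g y| by rewrite lt_def n0/=.
by move=> h2; rewrite -(ler_pM2r p0); nra.
Qed.

(** Both graph points are fed to the resolvent of the same step [g]: the terms in [B x] cancel and
    the two inputs differ by [(1 - g / g') S g' x]. *)
Lemma fb_residual_step (g g' : R) x : admissible g -> admissible g' ->
  `|S g x - S g' x| <= `|g - g'| / g' * `|S g' x|.
Proof.
move=> adm adm'; have [g0 g1 g2] := adm; have [g0' _ _] := adm'.
have := fb_residual_graph x adm'; have := fb_residual_graph x adm.
move: (S g x) (S g' x) => s s' As As'.
have := resolvent_nonexpansive Amax.1 g0 g1 As As'.
rewrite (_ : x - s - (x - s') = s' - s); last first.
  by rewrite opprB addrC addrA subrK.
rewrite distrC => /le_trans; apply.
rewrite (_ : _ - _ = (1 - g / g') *: s'); last first.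
  rewrite !scalerBr !scalerA divff ?gt_eqF// scale1r !addrA subrK.
  rewrite opprB addrA subrK opprD opprB addrA [x + _]addrC subrK.
  by rewrite scalerBl scale1r.
rewrite normrZ -{1}(divff (_ : g' != 0)) ?gt_eqF// -mulrBl normrM distrC.
by rewrite gtr0_norm ?invr_gt0.
Qed.

Lemma fb_residual_zer (g : R) z : admissible g ->
  S g z = 0 <-> zer (op_add A B) z.
Proof.
move=> adm; split=> [Sz|[u Az /eqP]].
  exists (- B z); last by rewrite addNr.
  by have := fb_residual_graph z adm; rewrite Sz subr0 scaler0 sub0r.
rewrite addr_eq0 => /eqP uE; apply: fb_residual_unique => //.
by rewrite subr0 scaler0 sub0r -uE.
Qed.

End forward_backward.

(** * Monotonicity from derivatives existing almost everywhere *)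

Section monotonicity.
Context {R : realType} {V : normedModType R}.
Local Notation mu := (@lebesgue_measure R).
Implicit Types (g : R -> V) (U N : set R) (s t T : R).

Lemma negligible_open_cover N (e : R) : mu.-negligible N -> 0 < e ->
  exists U, [/\ open U, N `<=` U & (mu U < e%:E)%E].
Proof.
move=> [M [mM M0 NM]] e0.
have Moo : (mu M < +oo)%E by rewrite M0 ltry.
have [U [oU MU Ue]] := lebesgue_regularity_outer mM Moo e0.
exists U; split => //; first exact: subset_trans MU.
have mU : measurable U by exact: open_measurable.
have -> : U = M `|` (U `\` M) by rewrite setDUK.
apply: le_lt_trans (measureU2 _ mM (measurableD mU mM)) _.
by rewrite [X in (X + _)%E](_ : _ = 0%E)// add0e.
Qed.

Lemma sum_itv_le_measure n (l r : 'I_n -> R) U : measurable U ->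
  (forall i, l i <= r i) -> (forall i, `]l i, r i[ `<=` U) ->
  (forall i j, i != j -> `]l i, r i[ `&` `]l j, r j[ = set0) ->
  ((\sum_(i < n) (r i - l i))%:E <= mu U)%E.
Proof.
move=> mU lr lrU disj.
have -> : ((\sum_(i < n) (r i - l i))%:E = \sum_(i < n) mu `]l i, r i[%classic)%E.
  rewrite -sumEFin; apply: eq_bigr => i _; rewrite lebesgue_measure_itv/= lte_fin.
  case: ltP => [//|h]; have /eqP -> : r i == l i by rewrite eq_le h lr.
  by rewrite subrr.
rewrite -(measure_bigsetU_ord mu xpredT (F := fun i => `]l i, r i[%classic))//.
- apply: le_measure; rewrite ?inE//; first exact: bigsetU_measurable.
  by apply: (big_ind (fun A : set R => A `<=` U)) => // A B AU BU x [/AU|/BU].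
- by apply/trivIsetP => i j _ _; exact: disj.
Qed.

(** The supremum is the variation of [g] plus the length carried by the part of [U] between [s] and
    [t]. *)
Definition variation_sums g U s t : set R :=
  [set v | exists n (l r : 'I_n -> R),
    [/\ forall i, s <= l i <= r i /\ r i <= t,
        forall i, `[l i, r i] `<=` U,
        forall i j, i != j -> `]l i, r i[ `&` `]l j, r j[ = set0 &
        v = \sum_(i < n) (`|g (r i) - g (l i)| + (r i - l i))]].

Lemma variation_sums0 g U s t : variation_sums g U s t 0.
Proof.
exists 0%N, (fun=> 0), (fun=> 0); split; try by case.
by rewrite big_ord0.
Qed.

Lemma sub_variation_sums g U s t t' : t <= t' ->
  variation_sums g U s t `<=` variation_sums g U s t'.
Proof.
move=> tt' v [n [l [r [h1 h2 h3 h4]]]]; exists n, l, r; split=> // i.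
by have [? ?] := h1 i; split=> //; exact: le_trans tt'.
Qed.

Lemma variation_sums_extend g U s t t' v : s <= t -> t <= t' -> `[t, t'] `<=` U ->
  variation_sums g U s t v ->
  variation_sums g U s t' (v + (`|g t' - g t| + (t' - t))).
Proof.
move=> st tt' tU [n [l [r [h1 h2 h3 h4]]]].
(* The new interval takes the last index, where [unlift] returns [None]. *)
pose l' (i : 'I_n.+1) := oapp l t (unlift ord_max i).
pose r' (i : 'I_n.+1) := oapp r t' (unlift ord_max i).
have lE i : l' (lift ord_max i) = l i by rewrite /l' liftK.
have rE i : r' (lift ord_max i) = r i by rewrite /r' liftK.
have l0 : l' ord_max = t by rewrite /l' unlift_none.
have r0 : r' ord_max = t' by rewrite /r' unlift_none.
have dj i : `]l i, r i[ `&` `]t, t'[ = set0.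
  rewrite -subset0 => x [] /=; rewrite !in_itv/= => /andP[_ xr] /andP[tx _].
  have := lt_le_trans xr (h1 i).2; by rewrite ltNge (ltW tx).
exists n.+1, l', r'; split.
- move=> i; case: (unliftP ord_max i) => [j ->|->].
    by rewrite lE rE; have [? ?] := h1 j; split=> //; exact: le_trans tt'.
  by rewrite l0 r0 st.
- by move=> i; case: (unliftP ord_max i) => [j ->|->]; rewrite ?lE ?rE ?l0 ?r0.
- move=> i j; case: (unliftP ord_max i) => [i' ->|->];
    case: (unliftP ord_max j) => [j' ->|->].
  + by rewrite (inj_eq lift_inj) !lE !rE; exact: h3.
  + by rewrite lE rE l0 r0 => _; exact: dj.
  + by rewrite lE rE l0 r0 setIC => _; exact: dj.
  + by rewrite eqxx.
- rewrite big_ord_recr/= l0 r0 h4; congr (_ + _); apply: eq_bigr => i _.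
  have -> : widen_ord (leqnSn n) i = lift ord_max i.
    by apply: ord_inj; rewrite lift_max.
  by rewrite lE rE.
Qed.

Lemma variation_sums_small g s T (e : R) : abs_continuous s T g -> 0 < e ->
  exists2 d, 0 < d & forall U, open U -> (mu U < d%:E)%E ->
    forall v, variation_sums g U s T v -> v <= e.
Proof.
move=> gac e0; have e2 : 0 < e / 2 by rewrite divr_gt0.
have [d d0 hd] := gac _ e2; exists (Num.min d (e / 2)); first by rewrite lt_min d0.
move=> U oU Ud v [n [l [r [h1 h2 h3 ->]]]].
have : ((\sum_(i < n) (r i - l i))%:E < (Num.min d (e / 2))%:E)%E.
  apply: le_lt_trans Ud; apply: sum_itv_le_measure => //.
  - exact: open_measurable.
  - by move=> i; have [/andP[]] := h1 i.
  - by move=> i; apply: subset_trans (h2 i); exact: subset_itv_oo_cc.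
rewrite lte_fin lt_min => /andP[sd se].
have := hd n l r h1 h3 sd.
by rewrite big_split/=; lra.
Qed.

Lemma variation_sup_extend g U s T t t' (e : R) :
  (forall v, variation_sums g U s T v -> v <= e) ->
  s <= t -> t <= t' -> t' <= T -> `[t, t'] `<=` U ->
  sup (variation_sums g U s t) + (`|g t' - g t| + (t' - t))
  <= sup (variation_sums g U s t').
Proof.
move=> he st tt' t'T tU; rewrite -lerBrDr; apply: ge_sup.
  by exists 0; exact: variation_sums0.
move=> v hv; rewrite lerBrDr; apply: sup_upper_bound.
  split; first by exists 0; exact: variation_sums0.
  by exists e => w hw; apply: he; exact: sub_variation_sums t'T w hw.
exact: variation_sums_extend.
Qed.

(* [p] stands for a small increasing function with infinite derivative on [N],
   relative to [g] and the identity: subtracting it from an interval function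
   removes the exceptional set [N]. *)
Lemma null_set_weight g s T N : s <= T -> abs_continuous s T g -> mu.-negligible N ->
  exists p : R -> R, [/\ forall t t', t <= t' -> t' <= T -> p t <= p t',
    0 <= p s, p T <= 1 &
    forall t (K : nat), N t -> exists2 d, 0 < d & forall l r,
      s <= l -> l <= r -> r <= T -> t - d < l -> r < t + d ->
      K%:R * (`|g r - g l| + (r - l)) <= p r - p l].
Proof.
move=> sT gac N0.
(* Coverings of [N] whose variation decays geometrically, so that infinitely many weights can be
   added. *)
have /choice [U hU] (k : nat) : exists U, [/\ open U, N `<=` U &
    forall v, variation_sums g U s T v -> v <= 2^-1 ^+ k.+1].
  have e0 : 0 < (2^-1 : R) ^+ k.+1 by rewrite exprn_gt0// invr_gt0.
  have [d d0 hd] := variation_sums_small gac e0.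
  by have [U [oU NU Ud]] := negligible_open_cover N0 d0; exists U; split=> //; exact: hd.
pose w k t := sup (variation_sums g (U k) s t).
have ub k t : t <= T -> has_sup (variation_sums g (U k) s t).
  move=> tT; split; first by exists 0; exact: variation_sums0.
  exists (2^-1 ^+ k.+1) => v hv; case: (hU k) => _ _; apply.
  exact: sub_variation_sums tT v hv.
have w_ge0 k t : t <= T -> 0 <= w k t.
  by move=> tT; apply: sup_upper_bound; [exact: ub|exact: variation_sums0].
have w_le k t : t <= T -> w k t <= 2^-1 ^+ k.+1.
  move=> tT; apply: ge_sup; first by exists 0; exact: variation_sums0.
  by move=> v hv; case: (hU k) => _ _; apply; exact: sub_variation_sums tT v hv.
have w_homo k t t' : t <= t' -> t' <= T -> w k t <= w k t'.
  move=> tt' t'T; apply: ge_sup; first by exists 0; exact: variation_sums0.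
  move=> v hv; apply: sup_upper_bound; first exact: ub.
  exact: sub_variation_sums tt' v hv.
(* The weights being nonnegative, the supremum of these partial sums is the full series. *)
pose P t := [set \sum_(k < n) w k t | n in [set: nat]].
have geo n : \sum_(k < n) (2^-1 : R) ^+ k.+1 <= 1.
  suff -> : \sum_(k < n) (2^-1 : R) ^+ k.+1 = 1 - 2^-1 ^+ n.
    by rewrite lerBlDr lerDl exprn_ge0// invr_ge0.
  elim: n => [|n IH]; first by rewrite big_ord0 expr0 subrr.
  by rewrite big_ord_recr/= IH exprS; field.
have ubP t : t <= T -> has_sup (P t).
  move=> tT; split; first by exists (\sum_(k < 0) w k t), 0%N.
  exists 1 => _ [n _ <-]; apply: le_trans (geo n).
  by apply: ler_sum => k _; exact: w_le.
exists (fun t => sup (P t)); split.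
- move=> t t' tt' t'T; apply: ge_sup; first by exists (\sum_(k < 0) w k t), 0%N.
  move=> _ [n _ <-]; apply: (@le_trans _ _ (\sum_(k < n) w k t')).
    by apply: ler_sum => k _; exact: w_homo.
  by apply: sup_upper_bound; [exact: ubP|exists n].
- by apply: sup_upper_bound; [exact: ubP|exists 0%N => //; rewrite big_ord0].
- apply: ge_sup; first by exists (\sum_(k < 0) w k T), 0%N.
  move=> _ [n _ <-]; apply: le_trans (geo n).
  by apply: ler_sum => k _; exact: w_le.
- move=> t K Nt.
  (* Near a point of [N] the first [K] open sets all contain the interval, so each of [K] weights
     grows by the full increment. *)
  have : \forall u \near t, forall k : 'I_K, U k u.
    apply: (@filter_forall _ 'I_K (fun k => U k) (nbhs t) _).
    by move=> k; have [oU NU _] := hU k; exact: (open_nbhs_nbhs (conj oU (NU _ Nt))).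
  move=> /nbhs_ballP[d /= d0 hd]; exists d => // l r sl lr rT tl rt.
  have lrU (k : 'I_K) : `[l, r] `<=` U k.
    move=> u; rewrite /= in_itv/= => /andP[lu ur]; apply: hd => /=.
    by rewrite /ball/= ltr_distlC; apply/andP; split; lra.
  have lT := le_trans lr rT.
  rewrite lerBrDl; set X := _ + (r - l).
  have X0 : 0 <= X by rewrite addr_ge0// subr_ge0.
  rewrite -lerBrDr; apply: ge_sup; first by exists (\sum_(k < 0) w k l), 0%N.
  move=> _ [n _ <-]; rewrite lerBrDr.
  apply: (@le_trans _ _ (\sum_(k < maxn K n) w k r)); last first.
    by apply: sup_upper_bound; [exact: ubP|exists (maxn K n)].
  have -> : K%:R * X = \sum_(k < maxn K n) (if (k < K)%N then X else 0).
    rewrite -big_mkcond -(big_ord_widen _ (fun=> X) (leq_maxl K n)).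
    by rewrite sumr_const card_ord mulr_natl.
  have : \sum_(k < n) w k l <= \sum_(k < maxn K n) w k l.
    rewrite (big_ord_widen _ (fun k => w k l) (leq_maxr K n)).
    rewrite big_mkcond/=; apply: ler_sum => k _; case: ifP => // _; exact: w_ge0.
  move=> /(lerD _) => /(_ _ _ (lexx (\sum_(k < maxn K n) (if (k < K)%N then X else 0)))).
  rewrite [leLHS]addrC => /le_trans; apply.
  rewrite -big_split/=; apply: ler_sum => k _; case: ifP => kK; last first.
    by rewrite add0r; exact: w_homo.
  rewrite addrC; have [_ _ h] := hU k.
  by apply: variation_sup_extend h _ _ _ (lrU (Ordinal kK)).
Qed.

(** Real induction: the supremum of the times [t] with [F s t <= 0] is itself such a time, and the
    local hypothesis there allows a further step unless it is [T]. *)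
Lemma locally_nonpositive_global (F : R -> R -> R) s T : s <= T ->
  (forall l m r, s <= l -> l <= m -> m <= r -> r <= T -> F l r <= F l m + F m r) ->
  (forall t, s <= t <= T -> exists2 d, 0 < d & forall u, s <= u <= T ->
     `|u - t| < d -> F (Num.min t u) (Num.max t u) <= 0) ->
  F s T <= 0.
Proof.
move=> sT Fsub Floc.
pose S := [set t | s <= t <= T /\ F s t <= 0].
have Ss : S s.
  split; first by rewrite lexx.
  have [|d d0 /(_ s)] := Floc s; first by rewrite lexx.
  by rewrite lexx subrr normr0 minxx maxxx; apply.
have hS : has_sup S by split; [exists s|exists T => t [/andP[]]].
set c := sup S.
have sc : s <= c by exact: sup_upper_bound.
have cT : c <= T by apply: ge_sup; [exists s|move=> t [/andP[]]].
have [|d d0 hd] := Floc c; first by rewrite sc.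
have [t [/andP[st tT] Ft] ct] := sup_adherent d0 hS.
have tc : t <= c by apply: (sup_upper_bound hS); split; rewrite ?st.
have Fc : F s c <= 0.
  apply: le_trans (Fsub _ _ _ (lexx s) st tc cT) _.
  have := hd t; rewrite st tT => /(_ isT); rewrite distrC ger0_norm ?subr_ge0//.
  by rewrite ltrBlDl -ltrBlDr ct (min_idPr tc) (max_idPl tc) => /(_ isT); lra.
have [<-//|cNT] := eqVneq c T.
have cltT : c < T by rewrite lt_neqAle cNT.
pose u := Num.min T (c + d / 2).
have cu : c < u by rewrite lt_min cltT ltrDl divr_gt0.
have uT : u <= T by rewrite ge_min lexx.
have su : s <= u by exact: le_trans (ltW cu).
have : S u.
  split; first by rewrite su.
  apply: le_trans (Fsub _ _ _ (lexx s) sc (ltW cu) uT) _.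
  have := hd u; rewrite su uT => /(_ isT); rewrite gtr0_norm ?subr_gt0//.
  have : u <= c + d / 2 by rewrite ge_min lexx orbT.
  rewrite (min_idPl (ltW cu)) (max_idPr (ltW cu)) => h.
  by move=> /(_ ltac:(lra)); lra.
by move=> /(sup_upper_bound hS); rewrite leNgt cu.
Qed.

(** Real induction is applied to [F] minus [e] times the increments of the identity and of the
    weight [p] of [N]. Off [N] the identity pays for [F]; on [N] the constant [K] varies with the
    point, but [p] outgrows every multiple of the dominating increment. The total price vanishes
    with [e]. *)
Lemma ae_nonpositive_global g (F : R -> R -> R) s T (N : set R) :
  abs_continuous s T g -> mu.-negligible N -> s <= T ->
  (forall l m r, s <= l -> l <= m -> m <= r -> r <= T -> F l r <= F l m + F m r) ->
  (forall t, s <= t <= T -> exists (K d : R), 0 < d /\ forall u, s <= u <= T ->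
     `|u - t| < d -> F (Num.min t u) (Num.max t u) <= K * (`|u - t| + `|g u - g t|)) ->
  (forall t, s <= t <= T -> ~ N t -> forall e, 0 < e -> exists2 d, 0 < d &
     forall u, s <= u <= T -> `|u - t| < d ->
       F (Num.min t u) (Num.max t u) <= e * `|u - t|) ->
  F s T <= 0.
Proof.
move=> gac N0 sT Fsub Fdom Fae.
have [p [phomo ps pT pN]] := null_set_weight sT gac N0.
have minmax (t u : R) : Num.max t u - Num.min t u = `|u - t|.
  by case: leP => h; [rewrite ger0_norm ?subr_ge0|rewrite distrC gtr0_norm ?subr_gt0].
have gminmax t u : `|g (Num.max t u) - g (Num.min t u)| = `|g u - g t|.
  by case: leP => // _; rewrite distrC.
have smin t u : s <= t <= T -> s <= u <= T ->
    [/\ s <= Num.min t u, Num.min t u <= Num.max t u & Num.max t u <= T].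
  move=> /andP[st tT] /andP[su uT]; rewrite le_min ge_max st su tT uT.
  by split=> //; rewrite ge_min !le_max lexx.
have key (e : R) : 0 < e -> F s T <= e * (T - s) + e * (p T - p s).
  move=> e0; rewrite -subr_le0.
  pose G l r := F l r - (e * (r - l) + e * (p r - p l)).
  rewrite -/(G s T); apply: locally_nonpositive_global => //.
    by move=> l m r sl lm mr rT; have := Fsub _ _ _ sl lm mr rT; rewrite /G; lra.
  move=> t tT; have [Nt|nNt] := pselect (N t); last first.
    have [d d0 hd] := Fae t tT nNt _ e0; exists d => // u uT ud.
    have [h1 h2 h3] := smin _ _ tT uT.
    have := hd u uT ud; have := phomo _ _ h2 h3; rewrite /G minmax => h4 h5.
    have : 0 <= e * (p (Num.max t u) - p (Num.min t u)).
      by rewrite mulr_ge0 ?subr_ge0// ltW.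
    lra.
  have [K [d [d0 hd]]] := Fdom t tT.
  (* Large enough for [e] times the growth of [p] to absorb [K]. *)
  pose n := (Num.truncn (`|K| / e)).+1.
  have Kn : K <= e * n%:R.
    rewrite mulrC -ler_pdivrMr//; apply: le_trans (_ : `|K| / e <= _).
      by rewrite ler_wpM2r ?invr_ge0 ?(ltW e0)// ler_norm.
    by apply/ltW; rewrite truncnS_gt.
  have [d' d'0 hd'] := pN t n Nt.
  exists (Num.min d d'); first by rewrite lt_min d0.
  move=> u uT; rewrite lt_min => /andP[ud ud'].
  have [h1 h2 h3] := smin _ _ tT uT.
  have := hd u uT ud; have := hd' _ _ h1 h2 h3.
  rewrite /G minmax gminmax.
  have lt1 : t - d' < Num.min t u.
    by move: ud'; rewrite ltr_distl lt_min => /andP[-> _]; rewrite ltrBlDr ltrDl d'0.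
  have lt2 : Num.max t u < t + d'.
    by move: ud'; rewrite ltr_distl gt_max => /andP[_ ->]; rewrite ltrDl d'0.
  move=> /(_ lt1 lt2); move: (p _ - p _) => q.
  have X0 : 0 <= `|u - t| + `|g u - g t| by rewrite addr_ge0.
  have := ler_wpM2r X0 Kn; have := mulr_ge0 (ltW e0) (normr_ge0 (u - t)).
  move: X0.
  rewrite (addrC `|g u - g t|).
  move: (`|u - t| + `|g u - g t|) => X X0 h4 h5 h6.
  have := ler_wpM2l (ltW e0) h6; lra.
apply/ler_addgt0Pr => e e0; rewrite add0r.
have D0 : 0 < T - s + 1 by lra.
have := key (e / (T - s + 1)) (divr_gt0 e0 D0).
have eE : e / (T - s + 1) * (T - s + 1) = e by rewrite divfK// gt_eqF.
have := ler_wpM2l (ltW (divr_gt0 e0 D0)) (_ : p T - p s <= 1).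
move=> /(_ ltac:(lra)); move: (e / _) eE => q; lra.
Qed.

End monotonicity.

(** * Calculus on a half-line *)

Section half_line_calculus.
Context {R : realType}.
Local Notation mu := (@lebesgue_measure R).

(** Division-free form of [hl_is_derive], without puncture at [s = t]. *)
Definition has_deriv {V : normedModType R} (t0 : R) (f : R -> V) (t : R) (l : V) :=
  forall e : R, 0 < e -> exists2 d : R, 0 < d & forall s, t0 <= s -> `|s - t| < d ->
    `|f s - f t - (s - t) *: l| <= e * `|s - t|.

(** The constants may vary with [t] without uniformity, so products with merely differentiable
    weights keep the property; it is what the monotonicity criterion asks on the exceptional null
    set. *)
Definition dominated_by {V W : normedModType R} (t0 : R) (g : R -> V) (f : R -> W)
    (t : R) :=
  exists K d : R, [/\ 0 <= K, 0 < d & forall s, t0 <= s -> `|s - t| < d ->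
    `|f s - f t| <= K * (`|s - t| + `|g s - g t|)].

(** Concerns both sides of [t] inside the half-line. Functions dominated by such an [f] are bounded
    near [t], as products require. *)
Definition right_bounded {V : normedModType R} (t0 : R) (f : R -> V) (t : R) :=
  exists2 d : R, 0 < d & forall s, t0 <= s -> `|s - t| < d -> `|f s - f t| <= 1.

Lemma hl_is_derive_has_deriv (V : normedModType R) t0 (f : R -> V) t l :
  hl_is_derive t0 f t l -> has_deriv t0 f t l.
Proof.
move=> /cvgrPdist_le h e e0.
have := h _ e0; rewrite /= near_withinE near_withinE => /nbhs_ballP[d /= d0 hd].
exists d => // s t0s st; have [->|sNt] := eqVneq s t.
  by rewrite !subrr scale0r subrr !normr0 mulr0.
have := hd s; rewrite /ball/= distrC => /(_ st sNt).
rewrite in_itv/= andbT => /(_ t0s).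
have k0 : s - t != 0 by rewrite subr_eq0.
have -> : f s - f t - (s - t) *: l = - ((s - t) *: (l - (s - t)^-1 *: (f s - f t))).
  by rewrite scalerBr scalerA divff// scale1r opprB.
by rewrite normrN normrZ mulrC => h'; rewrite ler_wpM2r.
Qed.

Lemma hl_derivable_has_deriv (V : normedModType R) t0 (f : R -> V) t :
  hl_derivable t0 f t -> has_deriv t0 f t (hl_deriv t0 f t).
Proof. by move=> [l hl]; apply: hl_is_derive_has_deriv; exact: cvgP hl. Qed.

Lemma has_deriv_cst (V : normedModType R) t0 (c : V) t : has_deriv t0 (fun=> c) t 0.
Proof.
move=> e e0; exists 1 => // s _ _.
by rewrite scaler0 subr0 subrr normr0 mulr_ge0// ltW.
Qed.

Lemma has_derivD (V : normedModType R) t0 (f g : R -> V) t f' g' :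
  has_deriv t0 f t f' -> has_deriv t0 g t g' ->
  has_deriv t0 (fun s => f s + g s) t (f' + g').
Proof.
move=> hf hg e e0; have e2 : 0 < e / 2 by rewrite divr_gt0.
have [d1 d10 h1] := hf _ e2; have [d2 d20 h2] := hg _ e2.
exists (Num.min d1 d2); first by rewrite lt_min d10.
move=> s t0s; rewrite lt_min => /andP[/(h1 _ t0s) k1 /(h2 _ t0s) k2].
rewrite scalerDr (opprD (f t)) (addrACA (f s)) opprD (addrACA (f s - f t)).
apply: le_trans (ler_normD _ _) _.
have -> : e = e / 2 + e / 2 by field.
by rewrite mulrDl; exact: lerD.
Qed.

Lemma has_deriv_bound (V : normedModType R) t0 (f : R -> V) t l :
  has_deriv t0 f t l -> exists2 d : R, 0 < d & forall s, t0 <= s ->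
    `|s - t| < d -> `|f s - f t| <= (`|l| + 1) * `|s - t|.
Proof.
move=> /(_ 1 ltr01)[d d0 hd]; exists d => // s t0s sd.
have := hd s t0s sd; rewrite -[f s - f t](subrK ((s - t) *: l)) addrK => h.
by apply: le_trans (ler_normD _ _) _; rewrite normrZ mulrDl mul1r; lra.
Qed.

Section dominated.
Context {V : normedModType R} (t0 : R) (g : R -> V).

Lemma has_deriv_dominated (W : normedModType R) (f : R -> W) t l :
  has_deriv t0 f t l -> dominated_by t0 g f t.
Proof.
move=> /has_deriv_bound[d d0 hd]; exists (`|l| + 1), d; split=> //.
move=> s t0s sd; apply: le_trans (hd s t0s sd) _.
by rewrite ler_wpM2l ?addr_ge0// lerDl.
Qed.

Lemma dominated_byxx t : dominated_by t0 g g t.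
Proof. by exists 1, 1; split=> // s _ _; rewrite mul1r lerDr. Qed.

Lemma dominated_byD (W : normedModType R) (f h : R -> W) t :
  dominated_by t0 g f t -> dominated_by t0 g h t ->
  dominated_by t0 g (fun s => f s + h s) t.
Proof.
move=> [K [d [K0 d0 hf]]] [K' [d' [K'0 d'0 hh]]].
exists (K + K'), (Num.min d d'); split; first by rewrite addr_ge0.
  by rewrite lt_min d0.
move=> s t0s; rewrite lt_min => /andP[/(hf s t0s) k1 /(hh s t0s) k2].
rewrite opprD addrACA mulrDl; apply: le_trans (ler_normD _ _) _; exact: lerD.
Qed.

Lemma dominated_right_bounded (W : normedModType R) (f : R -> W) t :
  right_bounded t0 g t -> dominated_by t0 g f t ->
  exists M d : R, [/\ 0 <= M, 0 < d & forall s, t0 <= s -> `|s - t| < d -> `|f s| <= M].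
Proof.
move=> [d d0 hg] [K [d' [K0 d'0 hf]]].
exists (`|f t| + K * 2), (Num.min 1 (Num.min d d')); split.
- by rewrite addr_ge0// mulr_ge0.
- by rewrite !lt_min ltr01 d0.
move=> s t0s; rewrite !lt_min => /andP[s1 /andP[/(hg s t0s) k1 /(hf s t0s) k2]].
rewrite -[f s](subrK (f t)) addrC; apply: le_trans (ler_normD _ _) _.
rewrite lerD2l; apply: le_trans k2 _; rewrite ler_wpM2l//; lra.
Qed.

End dominated.

(** * Product rules for bounded bilinear maps *)

Section bilinear_rules.
Context {U V W : normedModType R} (b : U -> V -> W).
Hypothesis bBl : forall u u' v, b (u - u') v = b u v - b u' v.
Hypothesis bBr : forall u v v', b u (v - v') = b u v - b u v'.
Hypothesis bZl : forall k u v, b (k *: u) v = k *: b u v.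
Hypothesis bZr : forall k u v, b u (k *: v) = k *: b u v.
Hypothesis b_le : forall u v, `|b u v| <= `|u| * `|v|.

Lemma has_deriv_bilinear t0 (f : R -> U) (h : R -> V) t f' h' :
  has_deriv t0 f t f' -> has_deriv t0 h t h' ->
  has_deriv t0 (fun s => b (f s) (h s)) t (b f' (h t) + b (f t) h').
Proof.
move=> df dh e e0.
have [d1 d10 h1] := has_deriv_bound dh.
(* The remainder splits into three pieces, each at most [E |s - t|] times a coefficient; [M]
   majorizes the sum of these coefficients. *)
pose M := `|h t| + 1 + `|f'| * (`|h'| + 1) + `|f t| + 1.
have M0 : 0 < M.
  by rewrite ltr_wpDl// !addr_ge0.
have [E ME q0] : exists2 E : R, E * M = e & 0 < E.
  by exists (e / M); [rewrite divfK// gt_eqF|rewrite divr_gt0].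
have [d2 d20 h2] := df _ q0; have [d3 d30 h3] := dh _ q0.
have l1 : 0 < `|h'| + 1 by rewrite ltr_wpDl.
(* Keeps [|h s - h t| <= 1] and makes the mixed second-order piece small. *)
pose d4 := Num.min (`|h'| + 1)^-1 (E).
have d40 : 0 < d4 by rewrite lt_min q0 invr_gt0 l1.
exists (Num.min (Num.min d1 d2) (Num.min d3 d4)); first by rewrite !lt_min d10 d20 d30 ?d40 ?invr_gt0 ?l1 ?q0.
move=> s t0s; rewrite !lt_min => /andP[/andP[/(h1 s t0s) k1 /(h2 s t0s) k2]
  /andP[/(h3 s t0s) k3 /andP[k4 k5]]].
rewrite (_ : _ - _ = b (f s - f t - (s - t) *: f') (h s)
    + (s - t) *: b f' (h s - h t) + b (f t) (h s - h t - (s - t) *: h')); last first.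
  rewrite !(bBl, bBr, bZl, bZr) scalerBr scalerDr.
  move: (b (f s) _) (b (f t) (h t)) (b (f t) (h s)) ((s - t) *: b f' (h t))
    ((s - t) *: b f' (h s)) ((s - t) *: b (f t) h') => p q r x z y.
  rewrite (addrA (p - r - z)) subrK -(addrA r) (addrA (p - r - x) r) (addrAC (p - r)) subrK.
  by rewrite opprD addrACA.
have hs : `|h s| <= `|h t| + 1.
  rewrite -[h s](subrK (h t)) addrC (le_trans (ler_normD _ _))// lerD2l.
  by apply: le_trans k1 _; rewrite mulrC -ler_pdivlMr// div1r ltW.
apply: le_trans (ler_normD _ _) _; rewrite -ME.
have a1 := b_le (f s - f t - (s - t) *: f') (h s).
have a3 := b_le (f t) (h s - h t - (s - t) *: h').
have a2 := b_le f' (h s - h t).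
have n1 : `|b (f s - f t - (s - t) *: f') (h s)| <= E * `|s - t| * (`|h t| + 1).
  apply: le_trans a1 _; apply: ler_pM => //.
have n2 : `|(s - t) *: b f' (h s - h t)| <= E * `|s - t| * (`|f'| * (`|h'| + 1)).
  rewrite normrZ; have a2' := le_trans a2 (ler_wpM2l (normr_ge0 f') k1).
  apply: le_trans (ler_wpM2l (normr_ge0 (s - t)) a2') _.
  have -> : `|s - t| * (`|f'| * ((`|h'| + 1) * `|s - t|)) =
    (`|s - t| * (`|f'| * (`|h'| + 1))) * `|s - t| by ring.
  rewrite [X in _ <= X](_ : _ = (`|s - t| * (`|f'| * (`|h'| + 1))) * E); last by ring.
  apply: ler_wpM2l; last exact: ltW.
  by rewrite !mulr_ge0.
have n3 : `|b (f t) (h s - h t - (s - t) *: h')| <= E * `|s - t| * `|f t|.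
  by apply: le_trans a3 _; rewrite mulrC ler_wpM2r.
have := ler_normD (b (f s - f t - (s - t) *: f') (h s)) ((s - t) *: b f' (h s - h t)).
have n4 : 0 <= E * `|s - t| by rewrite mulr_ge0// ltW.
move: n1 n2 n3 n4; rewrite /M; lra.
Qed.

Lemma dominated_by_bilinear (X : normedModType R) t0 (g : R -> X) (f : R -> U) (h : R -> V) t :
  right_bounded t0 g t -> dominated_by t0 g f t -> dominated_by t0 g h t ->
  dominated_by t0 g (fun s => b (f s) (h s)) t.
Proof.
move=> bg df dh; have [M [d [M0 d0 hM]]] := dominated_right_bounded bg df.
have [K [d1 [K0 d10 h1]]] := df; have [K' [d2 [K'0 d20 h2]]] := dh.
exists (M * K' + K * `|h t|), (Num.min d (Num.min d1 d2)); split.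
- by rewrite addr_ge0// mulr_ge0.
- by rewrite !lt_min d0 d10.
move=> s t0s; rewrite !lt_min => /andP[/(hM s t0s) k0 /andP[/(h1 s t0s) k1 /(h2 s t0s) k2]].
have -> : b (f s) (h s) - b (f t) (h t) = b (f s) (h s - h t) + b (f s - f t) (h t).
  by rewrite bBl bBr addrA subrK.
apply: le_trans (ler_normD _ _) _; rewrite mulrDl; apply: lerD.
  apply: le_trans (b_le _ _) _; rewrite -mulrA; exact: ler_pM.
by apply: le_trans (b_le _ _) _; rewrite mulrAC ler_wpM2r.
Qed.

End bilinear_rules.

Lemma has_derivN (V : normedModType R) t0 (f : R -> V) t l :
  has_deriv t0 f t l -> has_deriv t0 (fun s => - f s) t (- l).
Proof.
move=> h e /h[d d0 hd]; exists d => // s t0s /(hd s t0s).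
by rewrite -normrN !opprD scalerN !opprK.
Qed.

Lemma has_deriv_inv t0 (f : R -> R) t (l : R) : f t != 0 ->
  has_deriv t0 (f : R -> R^o) t l ->
  has_deriv t0 (fun s => (f s)^-1 : R^o) t (- (f t ^- 2 * l) : R).
Proof.
move=> ft0 df e e0.
have F0 : 0 < `|f t| by rewrite normr_gt0.
have l1 : 0 < `|l| + 1 by rewrite ltr_wpDl.
have M0 : 0 < `|f t| + `|l| by rewrite ltr_wpDr.
(* Chosen so that [E (|f t| + |l|)], which controls the numerator, is [e |f t|^3 / 2], at most
   [e |f t|^2 |f s|] once [|f s| >= |f t| / 2]. *)
pose E := e * (`|f t| ^+ 3 / 2) / (`|f t| + `|l|).
have E0 : 0 < E by rewrite !mulr_gt0 ?invr_gt0 ?exprn_gt0.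
have [d1 d10 h1] := has_deriv_bound df; have [d2 d20 h2] := df _ E0.
pose m := Num.min E (`|f t| / 2) / (`|l| + 1).
have m0 : 0 < m by rewrite divr_gt0// lt_min E0 divr_gt0.
exists (Num.min m (Num.min d1 d2)); first by rewrite !lt_min m0 d10 d20.
move=> s t0s; rewrite lt_min => /andP[k0]; rewrite lt_min => /andP[k1 k2].
have {k1} h1 : `|f s - f t| <= (`|l| + 1) * `|s - t| := h1 s t0s k1.
have {k2} h2 : `|f s - f t - (s - t) * l| <= E * `|s - t| := h2 s t0s k2.
have : `|f s - f t| < Num.min E (`|f t| / 2).
  by apply: le_lt_trans h1 _; rewrite mulrC -ltr_pdivlMr.
rewrite lt_min => /andP[fE f2].
have fs : `|f t| / 2 <= `|f s|.
  have := ler_normD (f s) (f t - f s); rewrite addrC subrK distrC; lra.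
have Fs0 : 0 < `|f s| by apply: lt_le_trans fs; rewrite divr_gt0.
have fs0 : f s != 0 by rewrite -normr_gt0.
change (`|(f s)^-1 - (f t)^-1 - (s - t) * - (f t ^- 2 * l)| <= e * `|s - t|).
have -> : (f s)^-1 - (f t)^-1 - (s - t) * - (f t ^- 2 * l) =
  ((s - t) * l * (f s - f t) - (f s - f t - (s - t) * l) * f t) / (f s * f t ^+ 2).
  by field; rewrite ft0 fs0.
rewrite normrM normfV ler_pdivrMr ?normr_gt0 ?mulf_neq0 ?expf_neq0//.
rewrite [`|f s * _|]normrM normrX.
apply: le_trans (ler_normB _ _) _; rewrite !normrM.
have b1 : `|s - t| * `|l| * `|f s - f t| <= `|s - t| * `|l| * E.
  by rewrite ler_wpM2l ?mulr_ge0// ltW.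
have b2 := ler_wpM2r (ltW F0) h2.
have EE : E * (`|f t| + `|l|) = e * (`|f t| ^+ 3 / 2) by rewrite /E divfK// gt_eqF.
have b3 : e * `|s - t| * (`|f t| ^+ 2 * (`|f t| / 2)) <= e * `|s - t| * (`|f t| ^+ 2 * `|f s|).
  apply: ler_wpM2l; first by rewrite mulr_ge0// ltW.
  by apply: ler_wpM2l; rewrite ?exprn_ge0.
have b4 : `|s - t| * (E * (`|f t| + `|l|)) = e * `|s - t| * (`|f t| ^+ 2 * (`|f t| / 2)).
  by rewrite EE; ring.
lra.
Qed.

Lemma has_derivM t0 (f h : R -> R^o) t f' h' :
  has_deriv t0 f t f' -> has_deriv t0 h t h' ->
  has_deriv t0 (fun s => f s * h s : R^o) t (f' * h t + f t * h').
Proof.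
apply: (has_deriv_bilinear (b := fun u v : R^o => u * v : R^o)).
- by move=> *; exact: mulrBl.
- by move=> *; exact: mulrBr.
- by move=> k u v; rewrite /GRing.scale/= mulrA.
- by move=> k u v; rewrite /GRing.scale/= mulrCA.
- by move=> u v; rewrite normrM.
Qed.

Lemma has_derivZ (V : normedModType R) t0 (f : R -> R^o) (h : R -> V) t f' h' :
  has_deriv t0 f t f' -> has_deriv t0 h t h' ->
  has_deriv t0 (fun s => f s *: h s) t (f' *: h t + f t *: h').
Proof.
apply: (has_deriv_bilinear (b := fun (u : R^o) (v : V) => u *: v)).
- by move=> *; exact: scalerBl.
- by move=> *; exact: scalerBr.
- by move=> k u v; rewrite scalerA.
- by move=> k u v; rewrite !scalerA mulrC.
- by move=> u v; rewrite normrZ.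
Qed.

Lemma dominated_byM (X : normedModType R) t0 (g : R -> X) (f h : R -> R^o) t :
  right_bounded t0 g t -> dominated_by t0 g f t -> dominated_by t0 g h t ->
  dominated_by t0 g (fun s => f s * h s : R^o) t.
Proof.
apply: (dominated_by_bilinear (b := fun u v : R^o => u * v : R^o)).
- by move=> *; exact: mulrBl.
- by move=> *; exact: mulrBr.
- by move=> u v; rewrite normrM.
Qed.

Lemma dominated_byZ (V X : normedModType R) t0 (g : R -> X) (f : R -> R^o) (h : R -> V) t :
  right_bounded t0 g t -> dominated_by t0 g f t -> dominated_by t0 g h t ->
  dominated_by t0 g (fun s => f s *: h s) t.
Proof.
apply: (dominated_by_bilinear (b := fun (u : R^o) (v : V) => u *: v)).
- by move=> *; exact: scalerBl.
- by move=> *; exact: scalerBr.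
- by move=> u v; rewrite normrZ.
Qed.

Lemma abs_continuousS (V : normedModType R) (g : R -> V) t0 s T :
  t0 <= s -> abs_continuous t0 T g -> abs_continuous s T g.
Proof.
move=> t0s gac e /gac[d d0 hd]; exists d => // n l r h; apply: hd => i.
by have [/andP[h1 h2] h3] := h i; rewrite (le_trans t0s h1).
Qed.

(** * Mean value inequalities outside a null set *)

Section increments.
Context {V : normedModType R} (t0 : R) (g : R -> V) (N : set R).
Hypotheses (gac : locally_abs_continuous t0 g) (N0 : mu.-negligible N).

(** The interval function [f r - f l - C (r - l)] is additive; the derivative controls it off [N]
    and domination controls it on [N]. Absolute continuity is asked of [g], not of [f]. *)
Lemma hl_increment_le (f : R -> R) (C s T : R) : t0 <= s -> s <= T ->
  (forall t, s <= t <= T -> dominated_by t0 g (f : R -> R^o) t) ->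
  (forall t, s <= t <= T -> ~ N t -> exists2 l : R, has_deriv t0 (f : R -> R^o) t l & l <= C) ->
  f T - f s <= C * (T - s).
Proof.
move=> t0s sT fdom fder; rewrite -subr_le0.
pose F l r : R := f r - f l - C * (r - l).
have minmax (t u : R) : F (Num.min t u) (Num.max t u) <= `|f u - f t| + `|C| * `|u - t|.
  have h1 := ler_norm (f u - f t); have h2 := ler_norm (f t - f u).
  have h3 := ler_norm (C * (u - t)); have h4 := ler_norm (- (C * (u - t))).
  rewrite /F; move: h1 h2 h3 h4; rewrite (distrC (f t)) normrN normrM.
  by case: (leP t u) => _; lra.
apply: (ae_nonpositive_global (g := g) (F := F) (N := N)) => //.
- exact: abs_continuousS t0s (gac T).
- by move=> l m r _ _ _ _; rewrite /F; lra.
- move=> t tT; have [K [d [K0 d0 hd]]] := fdom t tT.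
  exists (K + `|C|), d; split=> // u /andP[su _] ud.
  apply: le_trans (minmax t u) _; rewrite mulrDl; apply: lerD.
    by apply: hd => //; exact: le_trans su.
  by rewrite ler_wpM2l// lerDl.
- move=> t tT nNt e e0; have [l dl lC] := fder t tT nNt.
  have [d d0 hd] := dl _ e0; exists d => // u /andP[su _] ud.
  have := hd u (le_trans t0s su) ud; rewrite ler_norml /F => /andP[h1 h2].
  case: (leP t u) => h.
    have ut : 0 <= u - t by rewrite subr_ge0.
    have := ler_wpM2r ut lC; move: h2; rewrite ger0_norm// /GRing.scale/=; lra.
  have ut : 0 <= t - u by rewrite subr_ge0 ltW.
  have := ler_wpM2r ut lC; move: h1; rewrite distrC (ger0_norm ut)/GRing.scale/=; lra.
Qed.

(** The triangle inequality makes [|f r - f l| - C (r - l)] subadditive, so vector values need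
    neither functionals nor integrals. *)
Lemma hl_increment_norm_le (W : normedModType R) (f : R -> W) (C s T : R) :
  0 <= C -> t0 <= s -> s <= T ->
  (forall t, s <= t <= T -> dominated_by t0 g f t) ->
  (forall t, s <= t <= T -> ~ N t -> exists2 l : W, has_deriv t0 f t l & `|l| <= C) ->
  `|f T - f s| <= C * (T - s).
Proof.
move=> C0 t0s sT fdom fder; rewrite -subr_le0.
pose F l r : R := `|f r - f l| - C * (r - l).
have minmax (t u : R) : F (Num.min t u) (Num.max t u) = `|f u - f t| - C * `|u - t|.
  rewrite /F; case: (leP t u) => h; first by rewrite ger0_norm ?subr_ge0.
  by rewrite distrC (distrC u) ger0_norm// subr_ge0 ltW.
apply: (ae_nonpositive_global (g := g) (F := F) (N := N)) => //.
- exact: abs_continuousS t0s (gac T).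
- move=> l m r _ _ _ _; rewrite /F.
  by have := ler_distD (f m) (f r) (f l); lra.
- move=> t tT; have [K [d [K0 d0 hd]]] := fdom t tT.
  exists K, d; split=> // u /andP[su _] ud; rewrite minmax.
  apply: le_trans (hd u (le_trans t0s su) ud).
  by rewrite lerBlDr lerDl mulr_ge0.
- move=> t tT nNt e e0; have [l dl lC] := fder t tT nNt.
  have [d d0 hd] := dl _ e0; exists d => // u /andP[su _] ud; rewrite minmax.
  rewrite lerBlDr -[f u - f t](subrK ((u - t) *: l)).
  apply: le_trans (ler_normD _ _) (lerD (hd u (le_trans t0s su) ud) _).
  by rewrite normrZ mulrC ler_wpM2r.
Qed.

End increments.

Lemma abs_continuous_cst (V : normedModType R) t0 (c : V) :
  locally_abs_continuous t0 (fun=> c).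
Proof.
move=> T e e0; exists 1 => // n l r _ _ _.
by rewrite big1// => i _; rewrite subrr normr0.
Qed.

Lemma hl_deriv_increment_le t0 (f : R -> R) (C s T : R) : t0 <= s -> s <= T ->
  (forall t, s <= t <= T -> exists2 l : R, has_deriv t0 (f : R -> R^o) t l & l <= C) ->
  f T - f s <= C * (T - s).
Proof.
move=> t0s sT fder.
apply: (hl_increment_le (@abs_continuous_cst R^o t0 0) (@negligible_set0 _ _ _ mu)) => //.
- by move=> t /fder[l dl _]; exact: has_deriv_dominated dl.
- by move=> t /fder.
Qed.

Lemma hl_deriv_increment_norm_le t0 (W : normedModType R) (f : R -> W) (C s T : R) :
  0 <= C -> t0 <= s -> s <= T ->
  (forall t, s <= t <= T -> exists2 l : W, has_deriv t0 f t l & `|l| <= C) ->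
  `|f T - f s| <= C * (T - s).
Proof.
move=> C0 t0s sT fder.
apply: (hl_increment_norm_le (@abs_continuous_cst R^o t0 0) (@negligible_set0 _ _ _ mu)) => //.
- by move=> t /fder[l dl _]; exact: has_deriv_dominated dl.
- by move=> t /fder.
Qed.

End half_line_calculus.

(** * Asymptotic tools *)

Section asymptotics.
Context {R : realType}.

Lemma nonincreasing_ge0_cvg (E : R -> R) (t1 : R) :
  (forall s t, t1 <= s -> s <= t -> E t <= E s) -> (forall t, t1 <= t -> 0 <= E t) ->
  exists Einf : R, E t @[t --> +oo] --> Einf.
Proof.
move=> Edec E0; pose S := [set E t | t in [set t | t1 <= t]].
have hS : has_inf S.
  by split; [exists (E t1), t1 => /=|exists 0 => _ [t /= t1t <-]; exact: E0].
exists (inf S); apply/cvgrPdist_le => e e0.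
have [_ [t2 /= t12 <-] h] := inf_adherent e0 hS.
exists t2; split; first exact: num_real.
move=> t /ltW t2t; have t1t := le_trans t12 t2t.
have h1 : inf S <= E t by apply: (ge_inf hS.2); exists t.
have := Edec _ _ t12 t2t; rewrite distrC ger0_norm ?subr_ge0//; lra.
Qed.

(* In the time scale [ln m] the function [q] is Lipschitz and [|q|^2] is
   integrable. *)
Lemma log_time_vanishing {V : normedModType R} (q : R -> V) (E m : R -> R)
    (t1 L kap hi : R) :
  0 < L -> 0 < kap -> 0 <= hi ->
  (forall t, t1 <= t -> 0 < m t) ->
  (forall s t, t1 <= s -> s <= t -> m t <= m s + hi * (t - s)) ->
  (forall s t, t1 <= s -> s <= t -> `|q t - q s| <= L / m s * (t - s)) ->
  (forall s t d, t1 <= s -> s <= t -> 0 <= d ->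
     (forall u, s <= u <= t -> d <= `|q u| ^+ 2) ->
     E t - E s <= - (kap * d / m t) * (t - s)) ->
  (forall t, t1 <= t -> 0 <= E t) ->
  q t @[t --> +oo] --> 0.
Proof.
move=> L0 kap0 hi0 m0 mgrow qlip Edrop E0.
have Edec s t : t1 <= s -> s <= t -> E t <= E s.
  move=> t1s st; have := Edrop s t 0 t1s st (lexx _).
  rewrite mulr0 mul0r oppr0 mul0r subr_le0; apply => u _.
  exact: exprn_ge0.
have [Einf cE] := nonincreasing_ge0_cvg Edec E0.
apply/cvgrPdist_le => e e0.
(* Over a window of length [eta * m t] the Lipschitz bound lets [q] move by at most [e / 2], so
   [|q|] stays above [e / 2]. *)
pose eta := e / 2 / L; have eta0 : 0 < eta by rewrite !divr_gt0.
pose d := (e / 2) ^+ 2; have d0 : 0 < d by rewrite exprn_gt0// divr_gt0.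
(* Lower bound for the energy lost on such a window. It is independent of [t], because [m] grows
   there at most by the factor [1 + hi * eta]. *)
pose c := kap * d * eta / (1 + hi * eta).
have q0 : 0 < 1 + hi * eta by rewrite ltr_wpDr// mulr_ge0// ltW.
have c0 : 0 < c by rewrite !mulr_gt0// invr_gt0.
have c2 : 0 < c / 2 by rewrite divr_gt0.
move/cvgrPdist_lt : cE => /(_ _ c2)[t2 [_ ht2]].
exists (Num.max t1 t2); split; first exact: num_real.
move=> t; rewrite gt_max => /andP[/ltW t1t t2t] /=.
rewrite sub0r normrN leNgt; apply/negP => qe.
have mt0 := m0 _ t1t.
pose T := t + eta * m t.
have tT : t <= T by rewrite lerDl mulr_ge0 ?ltW.
have TE : T - t = eta * m t by rewrite /T addrC addKr.
have t1T := le_trans t1t tT.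
have drop : E T - E t <= - (kap * d / m T) * (T - t).
  apply: Edrop => //; first exact: ltW.
  move=> u /andP[tu uT]; rewrite /d ler_sqr ?nnegrE//; last by rewrite ltW// divr_gt0.
  have h : L / m t * (u - t) <= e / 2.
    apply: (@le_trans _ _ (L / m t * (T - t))).
      by apply: ler_wpM2l; [rewrite divr_ge0// ltW|rewrite lerD2r].
    rewrite TE /eta le_eqVlt; apply/orP; left; apply/eqP; field.
    by rewrite !gt_eqF.
  have := qlip t u t1t tu; have := ler_normD (q u) (q t - q u).
  by rewrite addrC subrK distrC; lra.
have mT : m T <= m t * (1 + hi * eta).
  by apply: le_trans (mgrow _ _ t1t tT) _; rewrite TE; lra.
have cle : c <= kap * d / m T * (T - t).
  have mT0 := m0 _ t1T; rewrite TE -subr_ge0.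
  have -> : kap * d / m T * (eta * m t) - c =
    kap * d * eta / (m T * (1 + hi * eta)) * (m t * (1 + hi * eta) - m T).
    by rewrite /c; field; rewrite !gt_eqF.
  apply: mulr_ge0; last by rewrite subr_ge0.
  by apply: divr_ge0; apply: ltW; [exact: mulr_gt0 (mulr_gt0 kap0 d0) eta0|exact: mulr_gt0].
have := ht2 _ t2t; have := ht2 _ (lt_le_trans t2t tT).
rewrite !ltr_distl => /andP[h1 h2] /andP[h3 h4].
move: drop; rewrite mulNr; lra.
Qed.

End asymptotics.

(** * Weak limits along ultrafilters and Opial's lemma *)

Section opial.
Context {R : realType} {H : completeNormedModType R}.
Context (ip : {dot H for idfun}) (ip_norm : induces_norm ip).
Implicit Types u v w x y z : H.

(** Bounded scalar functions converge along an ultrafilter because segments are compact. The limits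
    are linear in [y] and bounded by [M |y|], so Riesz representation turns them into a vector. *)
Lemma ultrafilter_weak_limit (x : R -> H) (U : set_system R) (M : R) :
  UltraFilter U -> (\forall t \near U, `|x t| <= M) ->
  exists p, forall y, ip (x t) y @[t --> U] --> ip p y.
Proof.
move=> UU xM.
have cvgU y : exists l : R, ip (x t) y @[t --> U] --> l.
  pose K := `[- (M * `|y|), M * `|y|]%classic : set R.
  have UK : \forall t \near U, K (ip (x t) y).
    near=> t; rewrite /K/= in_itv/= -ler_norml.
    apply: le_trans (ip_CauchySchwarz ip_norm _ _) _; rewrite ler_wpM2r//.
    by near: t.
  have [l [_ hl]] := @segment_compact R _ _ ((fun t => ip (x t) y) @ U) _ UK.
  exists l; apply/cvgrPdist_lt => e e0.
  have [//|UC] := in_ultra_setVsetC [set t | `|l - ip (x t) y| < e] UU.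
  have [z [/= [t ht <-] lz]] := hl [set ip (x t) y | t in ~` [set t | `|l - ip (x t) y| < e]] (ball l e)
    (filterS (fun t ht => ex_intro2 _ _ t ht erefl) UC) (nbhsx_ballx l e e0).
  by [].
have /choice[f hf] := cvgU.
have lim_uniq (h : R -> R) (a b : R) : h t @[t --> U] --> a -> h t @[t --> U] --> b -> a = b.
  by move=> ha hb; rewrite -(cvg_lim (@Rhausdorff R) ha); exact: cvg_lim.
have [|||p hp] := riesz_representation ip_norm (f := f) (M := M).
- move=> u v; apply: lim_uniq (hf _) _.
  under eq_fun do rewrite ipDr; exact: cvgD.
- move=> k u; apply: lim_uniq (hf _) _.
  under eq_fun do rewrite ipZr; exact: cvgMr.
- move=> y; apply/ler_addgt0Pr => e e0.
  move/cvgrPdist_lt : (hf y) => /(_ _ e0) h.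
  have [t [h1 h2]] := filter_ex (filterI h xM).
  have := ler_normD (f y - ip (x t) y) (ip (x t) y); rewrite subrK.
  have := ip_CauchySchwarz ip_norm (x t) y; have := ler_wpM2r (normr_ge0 y) h2.
  by move: h1; lra.
exists p => y; rewrite -hp; exact: hf.
Unshelve. all: by end_near.
Qed.

(** For [p], [p'] in [Z], [ip (x t) (p - p')] is affine in two convergent squared distances; its
    limit equals both [ip p (p - p')] and [ip p' (p - p')], so all ultrafilter limits coincide. *)
Lemma opial (x : R -> H) (Z : set H) : Z !=set0 ->
  (forall z, Z z -> exists l : R, `|x t - z| @[t --> +oo] --> l) ->
  (forall (U : set_system R) p, UltraFilter U -> +oo `<=` U ->
     (forall y, ip (x t) y @[t --> U] --> ip p y) -> Z p) ->
  exists2 p, Z p & weak_cvg ip x p.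
Proof.
move=> [z0 Z0] xlim xclus.
have [M xM] : exists M, \forall t \near +oo, `|x t| <= M.
  have [l hl] := xlim _ Z0; exists (l + 1 + `|z0|).
  move/cvgrPdist_lt : hl => /(_ 1 ltr01); apply: filterS => t.
  rewrite ltr_distl => /andP[h _]; have := ler_normD (x t - z0) z0.
  by rewrite subrK; lra.
have wlim (U : set_system R) : UltraFilter U -> +oo `<=` U ->
    exists2 p, Z p & forall y, ip (x t) y @[t --> U] --> ip p y.
  move=> UU sU; have [p hp] := ultrafilter_weak_limit UU (sU _ xM).
  by exists p => //; exact: xclus hp.
have wuniq (U U' : set_system R) p p' : UltraFilter U -> UltraFilter U' ->
    +oo `<=` U -> +oo `<=` U' -> Z p -> Z p' ->
    (forall y, ip (x t) y @[t --> U] --> ip p y) ->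
    (forall y, ip (x t) y @[t --> U'] --> ip p' y) -> p = p'.
  move=> UU UU' sU sU' Zp Zp' hp hp'.
  have [l hl] := xlim _ Zp; have [l' hl'] := xlim _ Zp'.
  pose c := (l' ^+ 2 - l ^+ 2 + (ip p p - ip p' p')) / 2.
  have hc : ip (x t) (p - p') @[t --> +oo] --> c.
    have -> : (fun t => ip (x t) (p - p')) = (fun t => (`|x t - p'| ^+ 2 - `|x t - p| ^+ 2
        + (ip p p - ip p' p')) / 2).
      apply/funext => t; rewrite -!ip_norm !ipE (ipC ip p (x t)) (ipC ip p' (x t)).
      by field.
    apply: cvgMl; apply: cvgD; last exact: cvg_cst.
    by apply: cvgB; rewrite !expr2; apply: cvgM.
  have e1 : c = ip p (p - p').
    have h1 : ip (x t) (p - p') @[t --> U] --> c by move=> A /hc /sU.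
    by rewrite -(cvg_lim (@Rhausdorff R) h1); exact: cvg_lim.
  have e2 : c = ip p' (p - p').
    have h1 : ip (x t) (p - p') @[t --> U'] --> c by move=> A /hc /sU'.
    by rewrite -(cvg_lim (@Rhausdorff R) h1); exact: cvg_lim.
  apply/eqP; rewrite -subr_eq0; apply/eqP; apply: (ip_eq0 ip_norm).
  by rewrite ipBl -e1 -e2 subrr.
have [U [UU sU]] := @ultraFilterLemma R +oo _.
have [p Zp hp] := wlim U UU sU; exists p => // y.
apply/cvgrPdist_lt => e e0; apply: contrapT => nh.
pose D := [set t | ~ `|ip p y - ip (x t) y| < e].
(* If convergence in direction [y] failed, the bad times [D] would meet every neighbourhood of
   [+oo], and some ultrafilter would refine both. *)
have FD : ProperFilter (within D +oo).
  split; last exact: within_filter.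
  move=> h; apply: nh.
  have {}h : \forall t \near +oo, D t -> False by exact: h.
  by near=> t; apply: contrapT; near: t.
have [U' [UU' sU']] := ultraFilterLemma FD.
have sU'oo : +oo `<=` U'.
  by move=> A hA; apply: sU'; apply: filterS hA => t At _.
have [p' Zp' hp'] := wlim U' UU' sU'oo.
have pE := wuniq _ _ _ _ UU UU' sU sU'oo Zp Zp' hp hp'.
have UD : U' D by apply: sU'; apply: (@filterE _ +oo).
have := hp' y; rewrite -pE => /cvgrPdist_lt /(_ _ e0) h.
by have [t [h1 h2]] := filter_ex (filterI h UD).
Unshelve. all: by end_near.
Qed.
End opial.

(** * Bounds extracted from infima, lower limits and Landau relations *)

Section preliminaries.
Context {R : realType}.
Local Notation infty := (at_pinfty R).

(** [inf] defaults to 0 on sets without an infimum, a case that positivity excludes. *)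
Lemma inf_gt0_lbound (S : set R) : 0 < inf S -> lbound S (inf S).
Proof.
move=> S0; apply: ge_inf; have [[]//|/inf_out S0'] := pselect (has_inf S).
by rewrite S0' ltxx in S0.
Qed.

Lemma limf_einf_gt0 (f : R -> R) (F : set_system R) :
  (0 < limf_einf (fun t => (f t)%:E) F)%E ->
  exists2 k : R, 0 < k & exists2 V, F V & forall t, V t -> k <= f t.
Proof.
rewrite limf_einfE => /ereal_sup_gt[_ [V FV <-] h].
have hV t : V t -> (ereal_inf [set (f x)%:E | x in V] <= (f t)%:E)%E.
  by move=> Vt; apply: ereal_inf_lbound; exists t.
move: h hV; case: (ereal_inf _) => [k|_ hV|//].
  by rewrite lte_fin => k0 hV; exists k => //; exists V => // t /hV; rewrite lee_fin.
(* An infimum [+oo] of real values means that [V] is empty, so any constant works. *)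
by exists 1 => //; exists V => // t /hV; rewrite leye_eq.
Qed.

Lemma pinfty_ge (t0 : R) (P : set R) : (\forall t \near +oo, P t) ->
  exists2 t1, t0 <= t1 & forall t, t1 <= t -> P t.
Proof.
move=> [M [_ hM]]; exists (Num.max t0 (M + 1)); first by rewrite le_max lexx.
move=> t; rewrite ge_max => /andP[_ h]; apply: hM; lra.
Qed.

Lemma bigO_pinfty (f g : R -> R^o) : f =O_infty g ->
  exists2 K : R, 0 < K & (\forall t \near +oo, `|f t| <= K * `|g t|).
Proof. by move=> /eqOP/bigO_exP. Qed.

Lemma has_deriv_hl_is_derive (V : normedModType R) t0 (f : R -> V) t l :
  has_deriv t0 f t l -> hl_is_derive t0 f t l.
Proof.
move=> h; apply/cvgrPdist_le => e e0; rewrite near_withinE near_withinE.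
have [d d0 hd] := h _ e0.
apply/nbhs_ballP; exists d => //= s; rewrite /ball/= distrC => sd sNt.
rewrite in_itv/= andbT => t0s; have := hd s t0s sd.
have k0 : s - t != 0 by rewrite subr_eq0.
have -> : f s - f t - (s - t) *: l = - ((s - t) *: (l - (s - t)^-1 *: (f s - f t))).
  by rewrite scalerBr scalerA divff// scale1r opprB.
by rewrite normrN normrZ mulrC ler_pM2r// normr_gt0.
Qed.

Lemma abs_continuous_right_bounded (V : normedModType R) t0 (g : R -> V) t :
  locally_abs_continuous t0 g -> t0 <= t -> right_bounded t0 g t.
Proof.
move=> gac t0t; have [d d0 hd] := gac (t + 1) 1 ltr01.
exists (Num.min d 1); first by rewrite lt_min d0 ltr01.
move=> s t0s; rewrite lt_min => /andP[sd s1].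
have := hd 1%N (fun=> Num.min s t) (fun=> Num.max s t).
rewrite !big_ord1 => h.
have minmax : Num.max s t - Num.min s t = `|s - t|.
  by case: leP => st; [rewrite distrC ger0_norm ?subr_ge0|rewrite gtr0_norm ?subr_gt0].
have gminmax : `|g (Num.max s t) - g (Num.min s t)| = `|g s - g t|.
  by case: leP => // _; rewrite distrC.
rewrite minmax gminmax in h; apply/ltW/h => //.
- move=> _; rewrite le_min t0s t0t/= ge_max; split; first by rewrite ge_min !le_max lexx.
  by move: s1; rewrite ltr_distl => /andP[_ /ltW ->]; rewrite /= lerDl ler01.
- by move=> i j; rewrite !ord1 eqxx.
Qed.

Lemma le_of_sqr_le (u K : R) : 0 <= K -> u ^+ 2 <= K -> u <= K + 1.
Proof.
move=> K0 h; rewrite leNgt; apply/negP => hu.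
have : 0 < (u - (K + 1)) * (u + K + 1) by rewrite mulr_gt0//; lra.
nra.
Qed.

End preliminaries.

(** * Algebra of the energy dissipation *)

Section dissipation.
Context {R : realType} {H : completeNormedModType R}.
Context (ip : {dot H for idfun}) (ip_norm : induces_norm ip).
Implicit Types u v w x y z : H.

(** The hypothesis is exactly the vanishing of the coefficient of [ip X Y]; the coefficients of
    [ip Y Y], [ip X T] and [ip Y T] are those named [Wv], [Q1] and [Q2]. *)
Lemma energy_derivative (X Y T : H) (a a' m m' c c' al be be' b : R) :
  m * a' + a * (a + m' - m * al) + c = 0 ->
  let x' := Y - be *: T in
  let y' := (al * be - b + be') *: T - al *: Y in
  let v := a *: X + m *: Y in
  let v' := (a' *: X + a *: x') + (m' *: Y + m *: y') in
  let k := a * be + m * (b - be' - al * be) in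
  2^-1 * ((ip v' v + ip v v') + (c' * ip X X + c * (ip x' X + ip X x'))) =
  (a * a' + 2^-1 * c') * ip X X - (- m * (a + m' - m * al)) * ip Y Y
  - (a * k + c * be) * ip X T - m * k * ip Y T.
Proof.
move=> h /=; have -> : c = - (m * a' + a * (a + m' - m * al)) by lra.
by rewrite !ipE (ipC ip Y X) (ipC ip T X) (ipC ip T Y); field.
Qed.

(** Half of [w |Y|^2] is kept; the other half absorbs the cross term in [Y] and [T] at the price
    [q2^2 / (2 w) |T|^2], which is the fraction in [WT]. *)
Lemma dissipation_le (X Y T : H) (w q1 q2 L : R) : 0 < w -> 0 < L ->
  0 < q1 * L - q2 ^+ 2 / (2 * w) -> L * ip T T <= ip X T ->
  - w * ip Y Y - q1 * ip X T - q2 * ip Y T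
  <= - (2^-1 * w * ip Y Y + (q1 * L - q2 ^+ 2 / (2 * w)) * ip T T).
Proof.
move=> w0 L0 q0 hT.
have w2 : 0 < 2 * w by rewrite mulr_gt0.
(* The cocoercivity inequality is multiplied by [q1], whose sign is forced by the positivity of the
   combined coefficient. *)
have q1_ge0 : 0 <= q1.
  have : 0 <= q2 ^+ 2 / (2 * w) by rewrite divr_ge0 ?sqr_ge0// ltW.
  move=> h; rewrite -(pmulr_lge0 _ L0); lra.
have := ip_ge0 ip_norm (w *: Y + q2 *: T); rewrite !ipE (ipC ip T Y) => h.
have h1 : 0 <= (w * ip Y Y) / 2 + q2 * ip Y T + q2 ^+ 2 / (2 * w) * ip T T.
  rewrite -(pmulr_rge0 _ w2); apply: le_trans h _.
  rewrite le_eqVlt; apply/orP; left; apply/eqP; field; exact: lt0r_neq0.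
have := ler_wpM2l q1_ge0 hT.
move: (q2 ^+ 2 / _) h1 {q0} => s; lra.
Qed.

End dissipation.

(** * The trajectory *)

Section trajectory.
Context {R : realType} {H : completeNormedModType R}.
Context (ip : {dot H for idfun}) (ip_norm : induces_norm ip).
Context (t0 rho nu : R) (A : H -> set H) (B : H -> H) (p : params R).
Hypothesis std : standing_assumptions ip t0 rho nu A B p.
Context (x : R -> H).
Hypothesis sol : strong_solution t0 A B p x.
Local Notation D f := (hl_deriv t0 f).
Local Notation mu := (@lebesgue_measure R).

Definition fb_flow (t : R) : H := fb_residual (gamma p t) A B (x t).
Definition velocity (t : R) : H := D x t + beta p t *: Tflow A B p x t.
Local Notation T := (Tflow A B p x).
Local Notation y := velocity.
Local Notation xi := fb_flow.

Lemma step_bounds : exists lo hi : R, [/\ 0 < lo, - 2 * rho < lo, hi < 2 * nu &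
  forall t, t0 <= t -> lo <= gamma p t <= hi].
Proof.
have [lo [hi [+ h2 h3]]] := sa_gamma std; rewrite gt_max => /andP[h0 h1].
by exists lo, hi; split.
Qed.

Lemma step_admissible t : t0 <= t -> admissible_step rho nu (gamma p t).
Proof.
have [lo [hi [h0 h1 h2 h3]]] := step_bounds => /h3 /andP[h4 h5].
by split; lra.
Qed.

Lemma TflowE t : T t = (lambda p t)^-1 *: xi t.
Proof. by []. Qed.

Lemma fb_flowE t : t0 <= t -> xi t = lambda p t *: T t.
Proof.
by move=> /(sa_lambda std) l0; rewrite TflowE scalerA divff ?scale1r// gt_eqF.
Qed.

Lemma fb_flow_increment s t : t0 <= s -> t0 <= t ->
  `|xi s - xi t| <= 2 * `|x s - x t| + `|gamma p s - gamma p t| / gamma p t * `|xi t|.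
Proof.
move=> t0s t0t.
apply: le_trans (ler_distD (fb_residual (gamma p s) A B (x t)) _ _) (lerD _ _).
  exact: (fb_residual_lipschitz ip_norm (sa_A std) (sa_B std) _ _ (step_admissible t0s)).
exact: (fb_residual_step ip_norm B (sa_A std) _ (step_admissible t0s) (step_admissible t0t)).
Qed.

Lemma x_has_deriv t : t0 <= t -> has_deriv t0 x t (D x t).
Proof. by move=> t0t; apply: hl_derivable_has_deriv; apply: (sol_C1 sol).1. Qed.

Lemma gamma_has_deriv t : t0 <= t -> has_deriv t0 (gamma p) t (D (gamma p) t).
Proof.
by move=> t0t; apply: hl_derivable_has_deriv; have [[_ [h _] _] _] := sa_C1 std; exact: h.
Qed.

Lemma beta_has_deriv t : t0 <= t -> has_deriv t0 (beta p) t (D (beta p) t).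
Proof.
move=> t0t.
have [[[hl _] [hg _] [hd _]] [[hth _] [hph _] [hps _]]] := sa_C1 std.
have dl := hl_derivable_has_deriv (hl t t0t).
have dth := hl_derivable_has_deriv (hth t t0t).
have dph := hl_derivable_has_deriv (hph t t0t).
have dps := hl_derivable_has_deriv (hps t t0t).
have d1 := has_derivD (has_deriv_cst t0 (1 : R^o) t) (has_derivN dth).
have dG := has_derivD (has_derivM dth dph) (has_derivM d1 dps).
have d1G := has_derivD (has_deriv_cst t0 (1 : R^o) t) (has_derivN dG).
have G0 : 1 - Gam p t != 0 by rewrite gt_eqF// subr_gt0; exact: sa_Gam std t t0t.
have := has_derivM (has_derivM dl dth) (has_deriv_inv (f := fun s => 1 - Gam p s) G0 d1G).
move=> /has_deriv_hl_is_derive h.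
by apply: hl_derivable_has_deriv; eexists; exact: h.
Qed.

Lemma dx_right_bounded t : t0 <= t -> right_bounded t0 (D x) t.
Proof. exact: abs_continuous_right_bounded (sol_ac_deriv sol). Qed.

Lemma fb_flow_dominated t : t0 <= t -> dominated_by t0 (D x) xi t.
Proof.
move=> t0t.
have [K [d [K0 d0 h]]] := has_deriv_dominated (D x) (x_has_deriv t0t).
have [K' [d' [K'0 d'0 h']]] := has_deriv_dominated (D x) (gamma_has_deriv t0t).
have [g0 _ _] := step_admissible t0t.
exists (2 * K + K' / gamma p t * `|xi t|), (Num.min d d'); split.
- by rewrite addr_ge0 ?mulr_ge0// invr_ge0 ltW.
- by rewrite lt_min d0.
move=> s t0s; rewrite lt_min => /andP[/(h s t0s) k /(h' s t0s) k'].
apply: le_trans (fb_flow_increment t0s t0t) _.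
rewrite [X in _ <= X]mulrDl; apply: lerD; first by rewrite -mulrA ler_pM2l.
rewrite [X in _ <= X]mulrAC; apply: ler_wpM2r => //.
by rewrite [X in _ <= X]mulrAC; apply: ler_wpM2r; rewrite ?invr_ge0 ?(ltW g0).
Qed.

Lemma Tflow_dominated t : t0 <= t -> dominated_by t0 (D x) T t.
Proof.
move=> t0t; have [[[hl _] _ _] _] := sa_C1 std.
have l0 : lambda p t != 0 by rewrite gt_eqF//; exact: sa_lambda std t t0t.
apply: (dominated_byZ (dx_right_bounded t0t) _ (fb_flow_dominated t0t)).
exact: has_deriv_dominated (has_deriv_inv (f := lambda p) l0 (hl_derivable_has_deriv (hl t t0t))).
Qed.

Lemma velocity_dominated t : t0 <= t -> dominated_by t0 (D x) y t.
Proof.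
move=> t0t; apply: dominated_byD; first exact: dominated_byxx.
apply: (dominated_byZ (dx_right_bounded t0t) _ (Tflow_dominated t0t)).
exact: has_deriv_dominated (beta_has_deriv t0t).
Qed.

Lemma dxE t : D x t = y t - beta p t *: T t.
Proof. by rewrite /velocity addrK. Qed.

(* The equation is first order in [velocity]: the derivative of [T] disappears. *)
Lemma velocity_has_deriv : {ae mu, forall t, t0 <= t -> has_deriv t0 y t
  ((alpha t0 p t * beta p t - bcoef t0 p t + D (beta p) t) *: T t - alpha t0 p t *: y t)}.
Proof.
apply: negligibleS (sol_eq sol) => t /= nh h; apply: nh => t0t; have [x2 [dT [h1 h2 h3]]] := h t0t.
have dy := has_derivD (hl_is_derive_has_deriv h1)
  (has_derivZ (beta_has_deriv t0t) (hl_is_derive_has_deriv h2)).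
suff -> : (alpha t0 p t * beta p t - bcoef t0 p t + D (beta p) t) *: T t -
    alpha t0 p t *: y t = x2 + (D (beta p) t *: T t + beta p t *: dT) by [].
have -> : x2 = - (alpha t0 p t *: D x t + beta p t *: dT + bcoef t0 p t *: T t).
  by apply/eqP; rewrite -addr_eq0 !addrA h3.
rewrite dxE; move: (y t) (T t) (alpha t0 p t) (beta p t) (bcoef t0 p t) => Y Z al be b.
move: (D (beta p) t) => be'.
rewrite !scalerDl !scalerDr scalerN scalerA scaleNr.
move: (al *: Y) (be *: dT) (b *: Z) ((al * be) *: Z) (be' *: Z) => Y' E G F F'.
rewrite !opprD opprK (addrC F' E) (addrA _ E) (addrAC (- Y' + F - E)) subrK.
by rewrite [LHS]addrC !addrA.
Qed.

End trajectory.

(** * The energy along a trajectory *)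

Section lyapunov.
Context {R : realType} {H : completeNormedModType R}.
Context (ip : {dot H for idfun}) (ip_norm : induces_norm ip).
Context (t0 rho nu : R) (A : H -> set H) (B : H -> H) (p : params R).
Hypothesis std : standing_assumptions ip t0 rho nu A B p.
Context (x : R -> H).
Hypothesis sol : strong_solution t0 A B p x.
Context (a m c : R -> R).
Hypothesis lyap : lyapunov_conditions t0 rho nu p a m c.
Context (z : H).
Hypothesis zerz : zer (op_add A B) z.
Local Notation D f := (hl_deriv t0 f).
Local Notation mu := (@lebesgue_measure R).
Local Notation T := (Tflow A B p x).
Local Notation y := (velocity t0 A B p x).
Local Notation xi := (fb_flow A B p x).
Local Notation X t := (x t - z).

Definition anchored (t : R) : H := a t *: X t + m t *: y t.

Definition energy (t : R) : R :=
  2^-1 * (ip (anchored t) (anchored t) + c t * ip (X t) (X t)).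

Lemma Lam_gt0 t : t0 <= t -> 0 < Lam rho nu p t.
Proof.
move=> t0t; apply: lt_le_trans (sa_Lam std) _; apply: inf_gt0_lbound (sa_Lam std) _ _.
by exists t => //=; rewrite in_itv/= andbT.
Qed.

Lemma fb_residual_zer0 t : t0 <= t -> fb_residual (gamma p t) A B z = 0.
Proof.
by move=> t0t; apply/(fb_residual_zer ip_norm B (sa_A std) z (step_admissible std t0t)).
Qed.

Lemma Tflow_cocoercive t : t0 <= t -> Lam rho nu p t * ip (T t) (T t) <= ip (X t) (T t).
Proof.
move=> t0t; have l0 := sa_lambda std t0t.
have := fb_residual_cocoercive ip_norm (sa_A std) (sa_B std) (x t) z (step_admissible std t0t).
rewrite (fb_residual_zer0 t0t) subr0 -/(xi t) (fb_flowE std x t0t) -ip_norm !(ipZl, ipZr).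
rewrite /Lam; move: (_ / _) => k h; rewrite -(ler_pM2l l0).
by apply: le_trans h; rewrite le_eqVlt; apply/orP; left; apply/eqP; ring.
Qed.

Lemma energy_ge0 t : t0 <= t -> 0 <= energy t.
Proof.
move=> t0t; have [_ _ c0] := ly_pos lyap t0t.
by rewrite mulr_ge0 ?addr_ge0 ?(ip_ge0 ip_norm)// mulr_ge0 ?(ip_ge0 ip_norm)// ltW.
Qed.

Lemma X_has_deriv t : t0 <= t -> has_deriv t0 (fun s => X s) t (D x t).
Proof.
move=> t0t; rewrite -[D x t]addr0.
exact: has_derivD (x_has_deriv sol t0t) (has_deriv_cst t0 (- z) t).
Qed.

Lemma weights_have_deriv t : t0 <= t -> [/\ has_deriv t0 a t (D a t),
  has_deriv t0 m t (D m t) & has_deriv t0 c t (D c t)].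
Proof.
move=> t0t; have [da dm dc] := ly_derivable lyap t0t.
by split; apply: hl_derivable_has_deriv.
Qed.

Lemma has_deriv_ip (f h : R -> H) t f' h' :
  has_deriv t0 f t f' -> has_deriv t0 h t h' ->
  has_deriv t0 (fun s => ip (f s) (h s)) t (ip f' (h t) + ip (f t) h').
Proof.
apply: (has_deriv_bilinear (b := fun u v => ip u v : R)).
- by move=> *; exact: ipBl.
- by move=> *; exact: ipBr.
- by move=> *; exact: ipZl.
- by move=> *; exact: ipZr.
- exact: ip_CauchySchwarz.
Qed.

Lemma dominated_by_ip (f h : R -> H) t : t0 <= t ->
  dominated_by t0 (D x) f t -> dominated_by t0 (D x) h t ->
  dominated_by t0 (D x) (fun s => ip (f s) (h s)) t.
Proof.
move=> t0t; apply: (dominated_by_bilinear (b := fun u v => ip u v : R) _ _ _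
  (dx_right_bounded sol t0t)).
- by move=> *; exact: ipBl.
- by move=> *; exact: ipBr.
- exact: ip_CauchySchwarz.
Qed.

(** Holds also at the exceptional times where the energy may have no derivative, which is what
    allows them to be ignored. *)
Lemma energy_dominated t : t0 <= t -> dominated_by t0 (D x) energy t.
Proof.
move=> t0t; have [da dm dc] := weights_have_deriv t0t.
have b := dx_right_bounded sol t0t.
have dX := has_deriv_dominated (D x) (X_has_deriv t0t).
have dv : dominated_by t0 (D x) anchored t.
  apply: dominated_byD; apply: (dominated_byZ b) => //.
  - exact: has_deriv_dominated da.
  - exact: has_deriv_dominated dm.
  - exact (velocity_dominated ip_norm std sol t0t).
apply: (dominated_byM b).
  exact: has_deriv_dominated (has_deriv_cst t0 (2^-1 : R^o) t).
apply: dominated_byD; first exact: dominated_by_ip.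
apply: (dominated_byM b); first exact: has_deriv_dominated dc.
exact: dominated_by_ip.
Qed.

Lemma energy_has_deriv_le : {ae mu, forall t, t0 <= t -> exists2 l : R,
  has_deriv t0 energy t l &
  l <= - (2^-1 * Wv t0 p a m t * ip (y t) (y t)
          + WT t0 rho nu p a m c t * ip (T t) (T t))}.
Proof.
apply: negligibleS (negligibleU (velocity_has_deriv std sol)
  (negligibleU (ly_eq lyap) (negligibleU (ly_W lyap) (ly_le lyap)))).
move=> t /= nh; apply: contrapT => nU; apply: nh => t0t.
have vd : has_deriv t0 y t ((alpha t0 p t * beta p t - bcoef t0 p t + D (beta p) t) *: T t
    - alpha t0 p t *: y t).
  by apply: contrapT => h; apply: nU; left => /(_ t0t).
have eqm : m t * D a t + a t * (a t + D m t - m t * alpha t0 p t) + c t = 0.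
  by apply: contrapT => h; apply: nU; right; left => /(_ t0t).
have [W0 WT0] : 0 < Wv t0 p a m t /\ 0 < WT t0 rho nu p a m c t.
  by apply: contrapT => h; apply: nU; right; right; left => /(_ t0t).
have le0 : a t * D a t + 2^-1 * D c t <= 0.
  by apply: contrapT => h; apply: nU; right; right; right => /(_ t0t).
have [da dm dc] := weights_have_deriv t0t.
have dX := X_has_deriv t0t.
have dv := has_derivD (has_derivZ da dX) (has_derivZ dm vd).
have dE := has_derivM (has_deriv_cst t0 (2^-1 : R^o) t)
  (has_derivD (has_deriv_ip dv dv) (has_derivM dc (has_deriv_ip dX dX))).
eexists; first exact: dE.
rewrite mul0r add0r (dxE t0 A B p x t).
rewrite (energy_derivative ip (X t) (y t) (T t) (D c t) (beta p t) (D (beta p) t)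
  (bcoef t0 p t) eqm).
have := dissipation_le ip_norm (y t) W0 (Lam_gt0 t0t) WT0 (Tflow_cocoercive t0t).
have := ler_wpM2r (ip_ge0 ip_norm (X t)) le0; rewrite mul0r => h1 h2.
apply: le_trans h2.
rewrite /Wv /Q1 /Q2 /Kcal.
lra.
Qed.

End lyapunov.

(** * Dissipation rate and boundedness *)

Section growth.
Context {R : realType} {H : completeNormedModType R}.
Context (ip : {dot H for idfun}) (ip_norm : induces_norm ip).
Context (t0 rho nu : R) (A : H -> set H) (B : H -> H) (p : params R).
Hypothesis std : standing_assumptions ip t0 rho nu A B p.
Context (x : R -> H).
Hypothesis sol : strong_solution t0 A B p x.
Context (a m c : R -> R).
Hypothesis lyap : lyapunov_conditions t0 rho nu p a m c.
Hypothesis growth : growth_conditions t0 rho nu p a m c.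
Context (z : H).
Hypothesis zerz : zer (op_add A B) z.
Local Notation D f := (hl_deriv t0 f).
Local Notation mu := (@lebesgue_measure R).
Local Notation T := (Tflow A B p x).
Local Notation y := (velocity t0 A B p x).
Local Notation xi := (fb_flow A B p x).
Local Notation X t := (x t - z).
Local Notation E := (energy ip t0 A B p x a m c z).

Lemma m_gt0 t : t0 <= t -> 0 < m t.
Proof. by move=> t0t; have [] := ly_pos lyap t0t. Qed.

Lemma m_homo s t : t0 <= s -> s <= t -> m s <= m t.
Proof.
move=> t0s st; have [lo [hi [lo0 hm]]] := gr_dm growth.
have := @hl_deriv_increment_le R t0 (fun s => - m s) 0 s t t0s st.
rewrite mul0r => h; suff : - m t - - m s <= 0 by lra.
apply: h => u /andP[su _]; have t0u := le_trans t0s su.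
have [_ dm _] := weights_have_deriv lyap t0u.
exists (- D m u); first exact: has_derivN dm.
have /andP[h _] := hm _ t0u; lra.
Qed.

Lemma m_growth : exists2 hi : R, 0 <= hi &
  forall s t, t0 <= s -> s <= t -> m t <= m s + hi * (t - s).
Proof.
have [lo [hi [lo0 hm]]] := gr_dm growth; exists hi.
  by have /andP[h1 h2] := hm _ (lexx t0); lra.
move=> s t t0s st; rewrite addrC -lerBlDr; apply: (@hl_deriv_increment_le _ t0) => // u /andP[su _].
have t0u := le_trans t0s su; have [_ dm _] := weights_have_deriv lyap t0u.
exists (D m u); first exact: dm.
by have /andP[] := hm _ t0u.
Qed.

Lemma dissipation_rate : exists2 kap : R, 0 < kap & \forall t \near +oo, t0 <= t ->
  kap / m t * (`|m t *: y t| ^+ 2 + `|xi t| ^+ 2) <=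
  2^-1 * Wv t0 p a m t * ip (y t) (y t) + WT t0 rho nu p a m c t * ip (T t) (T t).
Proof.
have [lo [hi [lo0 hm]]] := gr_dm growth.
have [Cv Cv0 hWv] := gr_Wv growth.
have [k k0 [V FV hV]] := limf_einf_gt0 (gr_liminf growth).
(* The first constant comes from [Wv >= Cv lo m], the second from the lower limit and
   [|xi| = lambda |T|]. *)
exists (Num.min (2^-1 * Cv * lo) (k * lo)); first by rewrite lt_min !mulr_gt0.
apply: filterS FV => t /hV hk t0t.
have mt := m_gt0 t0t; have lt := sa_lambda std t0t.
have /andP[Dlo _] := hm _ t0t; have D0 := lt_le_trans lo0 Dlo.
rewrite (fb_flowE std x t0t); move: (y t) (T t) => Y Z.
rewrite -!ip_norm !(ipZl, ipZr).
have yy := ip_ge0 ip_norm Y; have TT := ip_ge0 ip_norm Z.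
move: (ip Y Y) (ip Z Z) yy TT => yy TT yy0 TT0.
have W1 : Cv * lo * m t <= Wv t0 p a m t.
  apply: le_trans (hWv t t0t); rewrite -mulrA ler_pM2l// mulrC ler_pM2l//.
have W2 : k * lo / m t * lambda p t ^+ 2 <= WT t0 rho nu p a m c t.
  have -> : WT t0 rho nu p a m c t =
    m t * WT t0 rho nu p a m c t / (D m t * lambda p t ^+ 2) * (D m t / m t * lambda p t ^+ 2).
    by field; rewrite !gt_eqF.
  have q0 : 0 <= lambda p t ^+ 2 / m t by rewrite divr_ge0 ?sqr_ge0// ltW.
  apply: (@le_trans _ _ (k * (D m t * (lambda p t ^+ 2 / m t)))).
    have := ler_wpM2l (ltW k0) (ler_wpM2r q0 Dlo); lra.
  rewrite [W in _ <= _ * W](_ : _ = D m t * (lambda p t ^+ 2 / m t)); last by ring.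
  by apply: ler_wpM2r hk; rewrite mulr_ge0// ltW.
set kap := Num.min _ _.
have k1 : kap <= 2^-1 * Cv * lo by rewrite ge_min lexx.
have k2 : kap <= k * lo by rewrite ge_min lexx orbT.
rewrite mulrDr; apply: lerD.
  have -> : kap / m t * (m t * (m t * yy)) = kap * m t * yy by field; rewrite gt_eqF.
  apply: ler_wpM2r => //; have := ler_wpM2r (ltW mt) k1; lra.
have -> : kap / m t * (lambda p t * (lambda p t * TT)) = kap / m t * lambda p t ^+ 2 * TT by ring.
apply: ler_wpM2r => //; apply: le_trans W2; apply: ler_wpM2r; first exact: sqr_ge0.
by apply: ler_wpM2r => //; rewrite invr_ge0 ltW.
Qed.

(** The level [d] stands in for an integral of the dissipation. Since [m] is nondecreasing,
    [1 / m t] bounds the rate below on all of [[s, t]]; [d = 0] gives monotonicity of the energy. *)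
Lemma energy_drop : exists kap t1 : R, [/\ 0 < kap, t0 <= t1 & forall s t d,
  t1 <= s -> s <= t -> 0 <= d ->
  (forall u, s <= u <= t -> d <= `|m u *: y u| ^+ 2 + `|xi u| ^+ 2) ->
  E t - E s <= - (kap * d / m t) * (t - s)].
Proof.
have [kap kap0 /(pinfty_ge t0)[t1 t01 hkap]] := dissipation_rate.
exists kap, t1; split=> // s t d t1s st d0 hd.
have t0s := le_trans t01 t1s.
apply: (hl_increment_le (sol_ac_deriv sol) (energy_has_deriv_le ip_norm std sol lyap zerz)) => //.
  by move=> u /andP[su _]; exact: (energy_dominated ip_norm std sol lyap z (le_trans t0s su)).
move=> u /andP[su ut] /contrapT /= h; have t0u := le_trans t0s su.
have [l dl lle] := h t0u; exists l => //; apply: le_trans lle _.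
rewrite lerN2; apply: le_trans (hkap u (le_trans t1s su) t0u).
have := hd u; rewrite su ut => /(_ isT) hdu.
apply: (@le_trans _ _ (kap / m u * d)); last first.
  by apply: ler_wpM2l => //; rewrite divr_ge0 ?ltW// m_gt0.
rewrite mulrAC; apply: ler_wpM2r => //; apply: ler_wpM2l; first exact: ltW.
rewrite lef_pV2 ?posrE ?m_gt0//; [exact: m_homo|exact: le_trans ut].
Qed.

(** The energy is nonincreasing: [c] bounded below controls [X], [a] bounded above then controls
    [m y], and [xi] is Lipschitz in [x] and vanishes at [z]. *)
Lemma trajectory_bounded : exists M t1 : R, [/\ 0 <= M, t0 <= t1 & forall t, t1 <= t ->
  [/\ `|X t| <= M, `|m t *: y t| <= M & `|xi t| <= M]].
Proof.
have [kap [t1 [kap0 t01 hE]]] := energy_drop.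
have ci0 := ly_inf_c lyap; set ci := inf _ in ci0.
have hci t : t0 <= t -> ci <= c t.
  by move=> t0t; apply: (inf_gt0_lbound (ly_inf_c lyap)); exists t => //=; rewrite in_itv/= andbT.
have [Am hAm] := gr_a growth.
have ha t : t0 <= t -> a t <= `|Am|.
  move=> t0t; apply: le_trans (ler_norm _); apply: hAm.
  by exists t => //=; rewrite in_itv/= andbT.
pose K := 2 * E t1.
have K0 : 0 <= K by rewrite mulr_ge0// (energy_ge0 ip_norm A B x lyap z t01).
have Kci : 0 <= K / ci by rewrite divr_ge0// ltW.
pose M1 := K / ci + 1; have M10 : 0 <= M1 by rewrite addr_ge0.
have Am0 : 0 <= `|Am| * M1 by rewrite mulr_ge0.
exists (K + 1 + `|Am| * M1 + 2 * M1), t1; split=> //; first by lra.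
move=> t t1t; have t0t := le_trans t01 t1t.
have : E t <= E t1.
  have := hE t1 t 0 (lexx _) t1t (lexx _); rewrite mulr0 mul0r oppr0 mul0r subr_le0.
  by apply => u _; rewrite addr_ge0 ?exprn_ge0.
rewrite {1}/energy ler_pdivrMl// -/K => hEt.
have [at0 mt ct] := ly_pos lyap t0t.
have XX0 := ip_ge0 ip_norm (X t).
have h1 : ip (anchored t0 A B p x a m z t) (anchored t0 A B p x a m z t) <= K.
  by apply: le_trans hEt; rewrite lerDl mulr_ge0// ltW.
have h2 : ci * ip (X t) (X t) <= K.
  apply: (@le_trans _ _ (c t * ip (X t) (X t))); first by rewrite ler_wpM2r// hci.
  by apply: le_trans hEt; rewrite lerDr (ip_ge0 ip_norm).
have XM : `|X t| <= M1.
  by apply: le_of_sqr_le => //; rewrite -ip_norm ler_pdivlMr// mulrC.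
have vM : `|anchored t0 A B p x a m z t| <= K + 1.
  by apply: le_of_sqr_le => //; rewrite -ip_norm.
split.
- lra.
- have -> : m t *: y t = anchored t0 A B p x a m z t - a t *: X t.
    by rewrite /anchored addrAC subrr add0r.
  apply: le_trans (ler_normB _ _) _; rewrite normrZ gtr0_norm//.
  have : a t * `|X t| <= `|Am| * M1 by apply: ler_pM => //; [exact: ltW|exact: ha].
  lra.
- have := fb_residual_lipschitz ip_norm (sa_A std) (sa_B std) (x t) z (step_admissible std t0t).
  rewrite (fb_residual_zer0 ip_norm std zerz t0t) subr0 -/(xi t); lra.
Qed.

Lemma mbeta_bound : exists2 Mb : R, 0 <= Mb &
  forall t, t0 <= t -> m t * beta p t / lambda p t <= Mb.
Proof.
have [Mb hMb] := gr_mbeta growth; exists `|Mb| => // t t0t.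
apply: le_trans (ler_norm _); apply: hMb.
by exists t => //=; rewrite in_itv/= andbT.
Qed.

(** [m x' = m y - (m beta / lambda) xi], a combination of bounded quantities. *)
Lemma dx_bound : exists2 C : R, 0 < C & \forall t \near +oo, m t * `|D x t| <= C.
Proof.
have [M [t1 [M0 t01 hM]]] := trajectory_bounded; have [Mb Mb0 hMb] := mbeta_bound.
exists (M + Mb * M + 1); first by rewrite ltr_wpDl ?addr_ge0 ?mulr_ge0.
near=> t; have t1t : t1 <= t by near: t; apply: nbhs_pinfty_ge; exact: num_real.
have t0t := le_trans t01 t1t; have [_ yM xiM] := hM t t1t.
have mt := m_gt0 t0t; have lt := sa_lambda std t0t.
have bt := sa_beta std t0t.
have k0 := divr_ge0 (mulr_ge0 (ltW mt) (ltW bt)) (ltW lt).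
rewrite (dxE t0 A B p x t) -{1}(gtr0_norm mt) -normrZ scalerBr scalerA.
have -> : (m t * beta p t) *: T t = (m t * beta p t / lambda p t) *: xi t.
  by rewrite TflowE scalerA.
apply: le_trans (ler_normB _ _) _; rewrite [`|_ *: xi t|]normrZ ger0_norm; last first.
  exact: k0.
have : m t * beta p t / lambda p t * `|xi t| <= Mb * M.
  by apply: ler_pM => //; exact: hMb.
by lra.
Unshelve. all: by end_near. Qed.

Lemma dgamma_bound : exists2 C : R, 0 < C & \forall t \near +oo, m t * `|D (gamma p) t| <= C.
Proof.
have [lo [hi [lo0 hm]]] := gr_dm growth.
have [glo [ghi [glo0 _ _ hg]]] := step_bounds std.
have [K K0 hK] := bigO_pinfty (gr_dgamma growth).
have hi0 : 0 < hi by have /andP[h1 h2] := hm _ (lexx t0); lra.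
have ghi0 : 0 < ghi by have /andP[h1 h2] := hg _ (lexx t0); lra.
exists (ghi * (K * hi)); first by rewrite !mulr_gt0.
near=> t; have t0t : t0 <= t by near: t; apply: nbhs_pinfty_ge; exact: num_real.
have mt := m_gt0 t0t; have /andP[Dlo Dhi] := hm _ t0t.
have /andP[glt ght] := hg _ t0t; have gt0 := lt_le_trans glo0 glt.
have : `|(`|D (gamma p) t| / gamma p t : R)| <= K * `|(D m t / m t : R)| by near: t; exact: hK.
have D0 : 0 <= D m t by lra.
rewrite (ger0_norm (divr_ge0 (normr_ge0 _) (ltW gt0))) (ger0_norm (divr_ge0 D0 (ltW mt))).
rewrite ler_pdivrMr// => h.
have := ler_wpM2l (ltW mt) h.
have -> : m t * (K * (D m t / m t) * gamma p t) = gamma p t * (K * D m t).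
  by field; rewrite gt_eqF.
move=> /le_trans; apply; apply: ler_pM => //; first exact: ltW.
- exact: mulr_ge0 (ltW K0) D0.
- by rewrite ler_pM2l.
Unshelve. all: by end_near. Qed.

End growth.

(** * Vanishing of the flows and convergence *)

Section convergence.
Context {R : realType} {H : completeNormedModType R}.
Context (ip : {dot H for idfun}) (ip_norm : induces_norm ip).
Context (t0 rho nu : R) (A : H -> set H) (B : H -> H) (p : params R).
Hypothesis std : standing_assumptions ip t0 rho nu A B p.
Context (x : R -> H).
Hypothesis sol : strong_solution t0 A B p x.
Context (a m c : R -> R).
Hypothesis lyap : lyapunov_conditions t0 rho nu p a m c.
Hypothesis growth : growth_conditions t0 rho nu p a m c.
Context (z : H).
Hypothesis zerz : zer (op_add A B) z.
Local Notation D f := (hl_deriv t0 f).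
Local Notation mu := (@lebesgue_measure R).
Local Notation T := (Tflow A B p x).
Local Notation y := (velocity t0 A B p x).
Local Notation xi := (fb_flow A B p x).
Local Notation X t := (x t - z).
Local Notation E := (energy ip t0 A B p x a m c z).

Local Notation my := (fun t => m t *: y t).

Lemma scaled_velocity_deriv_bound : exists C t1 : R, [/\ 0 < C, t0 <= t1 &
  {ae mu, forall t, t1 <= t -> exists2 l : H, has_deriv t0 my t l & m t * `|l| <= C}].
Proof.
have [M [t2 [M0 t02 hM]]] := trajectory_bounded ip_norm std sol lyap growth zerz.
have [Mb Mb0 hMb] := mbeta_bound growth.
have [lo [hi [lo0 hm]]] := gr_dm growth.
have [K K0 hK] := bigO_pinfty (gr_alpha growth).
have [K' K'0 hK'] := bigO_pinfty (gr_dbeta growth).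
have hi0 : 0 <= hi by have /andP[h1 h2] := hm _ (lexx t0); lra.
have [t1 t21 ht1] := pinfty_ge t2 (filterI hK hK').
have t01 := le_trans t02 t21.
exists (hi * M + (K' * hi * M + K * hi * (Mb * M)) + K * hi * M + 1), t1; split=> //.
  have q1 := mulr_ge0 hi0 M0; have q2 := mulr_ge0 Mb0 M0.
  have q3 := mulr_ge0 (ltW K'0) q1; have q4 := mulr_ge0 (ltW K0) q1.
  have q5 := mulr_ge0 (mulr_ge0 (ltW K0) hi0) q2; lra.
apply: negligibleS (velocity_has_deriv std sol) => t /= nh hv; apply: nh => t1t.
have t0t := le_trans t01 t1t; have t2t := le_trans t21 t1t.
have [_ yM xiM] := hM t t2t; have mt := m_gt0 lyap t0t.
have lt := sa_lambda std t0t; have bt := sa_beta std t0t; have al := sa_alpha std t0t.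
have /andP[Dlo Dhi] := hm _ t0t; have D0 : 0 <= D m t by lra.
have [_ dm _] := weights_have_deriv lyap t0t.
eexists; first exact: has_derivZ dm (hv t0t).
have [k1 k2] := ht1 t t1t.
have {k1} al_le : m t * alpha t0 p t <= K * hi.
  move: k1; rewrite (gtr0_norm al) (ger0_norm (divr_ge0 D0 (ltW mt))) (mulrA K (D m t)).
  by rewrite ler_pdivlMr// => k1; have := ler_wpM2l (ltW K0) Dhi; move: k1; lra.
have {k2} db_le : m t * (m t * `|D (beta p) t - bcoef t0 p t|) <= K' * (hi * lambda p t).
  move: k2; rewrite (ger0_norm (divr_ge0 (mulr_ge0 (ltW lt) D0) (sqr_ge0 (m t)))).
  rewrite (mulrA K' (lambda p t * D m t)) ler_pdivlMr ?exprn_gt0// expr2 => k2.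
  have := ler_wpM2l (ltW K'0) (ler_wpM2l (ltW lt) Dhi); move: k2; lra.
have xiE : lambda p t * `|T t| = `|xi t|.
  by rewrite (fb_flowE std x t0t); move: (T t) => Z; rewrite normrZ gtr0_norm.
have myE : `|m t *: y t| = m t * `|y t| by rewrite normrZ gtr0_norm.
move: yM xiM (hMb t t0t) xiE; rewrite myE.
move: (y t) (T t) `|xi t| (D (beta p) t) (beta p t) (bcoef t0 p t) (alpha t0 p t)
  (lambda p t) (D m t) bt al lt Dhi D0 al_le db_le.
move=> Y Z q be' be b al' la dm' be0 al0 la0 Dhi D0 al_le db_le yM xiM mb xiE.
have be_le : m t * be * `|Z| <= Mb * M.
  have -> : m t * be * `|Z| = m t * be / la * q by rewrite -xiE; field; rewrite gt_eqF.
  apply: ler_pM => //; last by rewrite -xiE mulr_ge0// ltW.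
  exact: divr_ge0 (mulr_ge0 (ltW mt) (ltW be0)) (ltW la0).
(* The growth conditions bound the difference of [be'] and [b], so these are paired and [al' * be]
   is treated apart. *)
have -> : al' * be - b + be' = (be' - b) + al' * be by ring.
have n1 : `|dm' *: Y + m t *: (((be' - b) + al' * be) *: Z - al' *: Y)| <=
    dm' * `|Y| + m t * ((`|be' - b| + al' * be) * `|Z| + al' * `|Y|).
  apply: le_trans (ler_normD _ _) _; rewrite !normrZ (ger0_norm D0) (gtr0_norm mt).
  apply: lerD => //; apply: ler_wpM2l; first exact: ltW.
  apply: le_trans (ler_normB _ _) _; rewrite !normrZ (gtr0_norm al0); apply: lerD => //.
  apply: ler_wpM2r => //; apply: le_trans (ler_normD _ _) _.
  by rewrite (gtr0_norm (mulr_gt0 al0 be0)).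
apply: le_trans (ler_wpM2l (ltW mt) n1) _.
have Y0 := normr_ge0 Y; have Z0 := normr_ge0 Z; have mY0 := mulr_ge0 (ltW mt) Y0.
have b1 : dm' * (m t * `|Y|) <= hi * M by apply: ler_pM.
have b2 : m t * al' * (m t * `|Y|) <= K * hi * M.
  by apply: ler_pM => //; exact: mulr_ge0 (ltW mt) (ltW al0).
have b3 : m t * al' * (m t * be * `|Z|) <= K * hi * (Mb * M).
  apply: ler_pM => //; first exact: mulr_ge0 (ltW mt) (ltW al0).
  exact: mulr_ge0 (mulr_ge0 (ltW mt) (ltW be0)) Z0.
have b4 : m t * (m t * `|be' - b|) * `|Z| <= K' * hi * M.
  apply: le_trans (ler_wpM2r Z0 db_le) _.
  rewrite (_ : K' * (hi * la) * `|Z| = K' * hi * (la * `|Z|)); last by ring.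
  by rewrite xiE ler_wpM2l// mulr_ge0// ltW.
lra.
Qed.

(** [m y] goes through its almost everywhere derivative, while [xi] inherits the bound from [x] and
    [gamma]. Monotonicity of [m] turns each bound [C / m u] into [C / m s]. *)
Lemma flows_lipschitz : exists L t1 : R, [/\ 0 < L, t0 <= t1 & forall s t, t1 <= s -> s <= t ->
  `|my t - my s| <= L / m s * (t - s) /\ `|xi t - xi s| <= L / m s * (t - s)].
Proof.
have [C1 [t1 [C10 t01 h1]]] := scaled_velocity_deriv_bound.
have [M [t2 [M0 t02 hM]]] := trajectory_bounded ip_norm std sol lyap growth zerz.
have [C2 C20 h2] := dx_bound ip_norm std sol lyap growth zerz.
have [C3 C30 h3] := dgamma_bound std lyap growth.
have [glo [ghi [glo0 _ _ hg]]] := step_bounds std.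
have [t3 t13 h23] := pinfty_ge (Num.max t1 t2) (filterI h2 h3).
move: t13; rewrite ge_max => /andP[t13 t23].
have C4 : 0 <= 2 * C2 + C3 / glo * M := addr_ge0 (mulr_ge0 (ler0n _ 2) (ltW C20))
  (mulr_ge0 (divr_ge0 (ltW C30) (ltW glo0)) M0).
exists (C1 + (2 * C2 + C3 / glo * M)), t3; split.
- exact: ltr_wpDr C4 C10.
- exact: le_trans t13.
move=> s t t3s st; have t0s : t0 <= s by apply: le_trans t01 (le_trans t13 t3s).
have ms := m_gt0 lyap t0s; have ts : 0 <= t - s by rewrite subr_ge0.
have bnd (V : normedModType R) (C : R) u (l : V) : s <= u -> 0 <= C ->
    m u * `|l| <= C -> `|l| <= C / m s.
  move=> su C0 h; rewrite ler_pdivlMr// mulrC; apply: le_trans h.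
  by apply: ler_wpM2r => //; exact (m_homo lyap growth t0s su).
have is0 : 0 <= (m s)^-1 by rewrite invr_ge0 ltW.
split.
  apply: (@le_trans _ _ (C1 / m s * (t - s))); last first.
    by apply: ler_wpM2r => //; apply: ler_wpM2r => //; rewrite lerDl.
  apply: (hl_increment_norm_le (sol_ac_deriv sol) h1 (f := my)) => //.
  - exact: divr_ge0 (ltW _) (ltW ms).
  - move=> u /andP[su _]; have t0u := le_trans t0s su.
    have [_ dm _] := weights_have_deriv lyap t0u.
    apply: (dominated_byZ (dx_right_bounded sol t0u)).
      exact: has_deriv_dominated dm.
    exact (velocity_dominated ip_norm std sol t0u).
  - move=> u /andP[su _] /contrapT /= h; have [|l dl hl] := h.
      exact: le_trans t13 (le_trans t3s su).
    by exists l => //; apply: (bnd _ _ u) => //; exact: ltW.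
have xs : `|x t - x s| <= C2 / m s * (t - s).
  apply: (@hl_deriv_increment_norm_le _ t0) => //; first exact: divr_ge0 (ltW _) (ltW ms).
  move=> u /andP[su _]; exists (D x u); first exact (x_has_deriv sol (le_trans t0s su)).
  by apply: (bnd _ _ u) => //; [exact: ltW|exact: (h23 u (le_trans t3s su)).1].
have gs : `|gamma p t - gamma p s| <= C3 / m s * (t - s).
  apply: (@hl_deriv_increment_norm_le _ t0) => //; first exact: divr_ge0 (ltW _) (ltW ms).
  move=> u /andP[su _]; exists (D (gamma p) u).
    exact (gamma_has_deriv std (le_trans t0s su)).
  by apply: (bnd _ _ u) => //; [exact: ltW|exact: (h23 u (le_trans t3s su)).2].
have t0t := le_trans t0s st.
apply: le_trans (fb_flow_increment ip_norm std x t0t t0s) _.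
have [_ _ xiM] := hM s (le_trans t23 t3s).
have /andP[gl _] := hg s t0s; have g0 := lt_le_trans glo0 gl.
have gq : `|gamma p t - gamma p s| / gamma p s * `|xi s| <= C3 / m s * (t - s) / glo * M.
  apply: ler_pM => //; first by rewrite divr_ge0// ltW.
  by apply: ler_pM; rewrite ?invr_ge0 ?(ltW g0)// lef_pV2 ?posrE.
have C1m : 0 <= C1 / m s * (t - s) by exact: mulr_ge0 (divr_ge0 (ltW C10) (ltW ms)) ts.
lra.
Qed.

Lemma flows_vanish : my t @[t --> +oo] --> (0 : H) /\ xi t @[t --> +oo] --> (0 : H).
Proof.
have [L [t1 [L0 t01 hL]]] := flows_lipschitz.
have [kap [t2 [kap0 t02 hE]]] := energy_drop ip_norm std sol lyap growth zerz.
have [hi hi0 hm] := m_growth lyap growth.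
pose t3 := Num.max t1 t2.
have t13 : t1 <= t3 by rewrite le_max lexx.
have t23 : t2 <= t3 by rewrite le_max lexx orbT.
have t03 := le_trans t01 t13.
split; apply: (@log_time_vanishing _ _ _ E m t3 L kap hi) => //.
- by move=> t t3t; exact (m_gt0 lyap (le_trans t03 t3t)).
- by move=> s t t3s st; exact (hm _ _ (le_trans t03 t3s) st).
- by move=> s t t3s st; have [] := hL s t (le_trans t13 t3s) st.
- move=> s t d t3s st d0 hd; apply: hE (le_trans t23 t3s) st d0 _ => u /hd/le_trans; apply.
  by rewrite lerDl exprn_ge0.
- by move=> t t3t; exact: (energy_ge0 ip_norm A B x lyap z (le_trans t03 t3t)).
- by move=> t t3t; exact (m_gt0 lyap (le_trans t03 t3t)).
- by move=> s t t3s st; exact (hm _ _ (le_trans t03 t3s) st).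
- by move=> s t t3s st; have [] := hL s t (le_trans t13 t3s) st.
- move=> s t d t3s st d0 hd; apply: hE (le_trans t23 t3s) st d0 _ => u /hd/le_trans; apply.
  by rewrite lerDr exprn_ge0.
- by move=> t t3t; exact: (energy_ge0 ip_norm A B x lyap z (le_trans t03 t3t)).
Qed.

Lemma dist_zer_cvg : exists l : R, `|X t| @[t --> +oo] --> l.
Proof.
have [M [t1 [M0 t01 hM]]] := trajectory_bounded ip_norm std sol lyap growth zerz.
have [kap [t2 [kap0 t02 hE]]] := energy_drop ip_norm std sol lyap growth zerz.
have [myV _] := flows_vanish.
have [ell ell0 hell] := gr_lim growth.
have [Einf cE] : exists Einf : R, E t @[t --> +oo] --> Einf.
  apply: (@nonincreasing_ge0_cvg _ E t2).
    move=> s t t2s st; have := hE s t 0 t2s st (lexx _).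
    rewrite mulr0 mul0r oppr0 mul0r subr_le0; apply => u _.
    by rewrite addr_ge0 ?exprn_ge0.
  by move=> t t2t; exact: (energy_ge0 ip_norm A B x lyap z (le_trans t02 t2t)).
have [Am hAm] := gr_a growth.
have cross : a t * ip (X t) (m t *: y t) @[t --> +oo] --> (0 : R).
  have h0 : `|Am| * M * `|m t *: y t| @[t --> +oo] --> (0 : R).
    rewrite -[W in _ --> W](mulr0 (`|Am| * M)) -(@normr0 _ H).
    by apply: cvgMr; apply: cvg_norm.
  apply: norm_cvg0; apply: (squeeze_cvgr _ (cvg_cst 0) h0).
  near=> t; have t1t : t1 <= t by near: t; apply: nbhs_pinfty_ge; exact: num_real.
  have t0t := le_trans t01 t1t; have [XM _ _] := hM t t1t.
  have [at0 _ _] := ly_pos lyap t0t.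
  rewrite normr_ge0/= normrM (gtr0_norm at0) -mulrA.
  apply: ler_pM => //; first exact: ltW.
    apply: le_trans (ler_norm _); apply: hAm.
    by exists t => //=; rewrite in_itv/= andbT.
  apply: le_trans (ip_CauchySchwarz ip_norm _ _) _; exact: ler_wpM2r.
have sq : (a t ^+ 2 + c t) * `|X t| ^+ 2 @[t --> +oo] --> 2 * Einf.
  have -> : (fun t => (a t ^+ 2 + c t) * `|X t| ^+ 2) = (fun t =>
      2 * E t - (2 * (a t * ip (X t) (m t *: y t)) + `|m t *: y t| * `|m t *: y t|)).
    apply/funext => t; rewrite /energy /anchored -!expr2 -!ip_norm.
    move: (m t *: y t) (X t) => Y Z; rewrite !(ipDl, ipDr, ipZl, ipZr) (ipC ip Y Z).
    by field.
  rewrite -[W in _ --> W]subr0; apply: cvgB; first exact: cvgMr.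
  rewrite -[W in _ --> W]addr0; apply: cvgD.
    by rewrite -[W in _ --> W](mulr0 2); exact: cvgMr.
  by rewrite -[W in _ --> W](mulr0 0) -(@normr0 _ H); apply: cvgM; apply: cvg_norm.
have sq' : `|X t| ^+ 2 @[t --> +oo] --> 2 * Einf / ell.
  have h : (a t ^+ 2 + c t) * `|X t| ^+ 2 / (a t ^+ 2 + c t) @[t --> +oo] --> 2 * Einf / ell.
    by apply: cvgM => //; apply: cvgV => //; rewrite gt_eqF.
  apply: cvg_trans h; apply: near_eq_cvg; near=> t.
  have t0t : t0 <= t by near: t; apply: nbhs_pinfty_ge; exact: num_real.
  have [at0 _ ct0] := ly_pos lyap t0t.
  by rewrite mulrAC divff ?mul1r// gt_eqF// addr_gt0// exprn_gt0.
exists (Num.sqrt (2 * Einf / ell)).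
have -> : (fun t => `|X t|) = (fun t => Num.sqrt (`|X t| ^+ 2)).
  by apply/funext => t; rewrite sqrtr_sqr normr_id.
by apply: continuous_cvg sq'; exact: sqrt_continuous.
Unshelve. all: by end_near. Qed.

(** A demiclosedness argument: cocoercivity between [x t] and [q] bounds [|r|^2] by terms containing
    either the vanishing residual or [ip (x t - q) r], which tends to 0 along [U]. *)
Lemma weak_cluster_zer (U : set_system R) (q : H) : UltraFilter U -> +oo `<=` U ->
  (forall v, ip (x t) v @[t --> U] --> ip q v) -> zer (op_add A B) q.
Proof.
move=> UU sU hq.
have [M [t1 [M0 t01 hM]]] := trajectory_bounded ip_norm std sol lyap growth zerz.
have [_ xiV] := flows_vanish.
have [glo [ghi [glo0 _ _ hg]]] := step_bounds std.
(* Freezing the step gives one fixed operator to which the weak limit applies; changing the step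
   costs a bounded factor. *)
pose g0 := gamma p t0.
have adm0 : admissible_step rho nu g0 := step_admissible std (lexx t0).
apply/(fb_residual_zer ip_norm B (sa_A std) q adm0).
set r := fb_residual g0 A B q.
have sV : fb_residual g0 A B (x t) @[t --> +oo] --> (0 : H).
  have h0 : (ghi / glo + 1) * `|xi t| @[t --> +oo] --> (0 : R).
    rewrite -[W in _ --> W](mulr0 (ghi / glo + 1)) -(@normr0 _ H).
    by apply: cvgMr; apply: cvg_norm.
  apply: norm_cvg0; apply: (squeeze_cvgr _ (cvg_cst 0) h0).
  near=> t; have t0t : t0 <= t by near: t; apply: nbhs_pinfty_ge; exact: num_real.
  rewrite normr_ge0/=.
  have /andP[gl gh] := hg t t0t; have /andP[gl0 gh0] := hg t0 (lexx t0).
  have gt0 := lt_le_trans glo0 gl.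
  have := fb_residual_step ip_norm B (sa_A std) (x t) adm0 (step_admissible std t0t).
  rewrite -/(xi t) => h.
  have := ler_normD (fb_residual g0 A B (x t) - xi t) (xi t); rewrite subrK.
  have : `|g0 - gamma p t| / gamma p t * `|xi t| <= ghi / glo * `|xi t|.
    apply: ler_wpM2r => //; apply: ler_pM => //; first by rewrite invr_ge0 ltW.
      by rewrite ler_norml /g0; apply/andP; split; lra.
    by rewrite lef_pV2 ?posrE.
  by move: h; lra.
apply: (ip_eq0 ip_norm); apply/ler_addgt0Pr => e e0; rewrite add0r.
(* Sum of the coefficients of the three error terms, each smaller than [e / K]. *)
pose K := 2 * `|r| + 2 * (M + `|z - q|) + 2.
have K0 : 0 < K by rewrite ltr_wpDl// addr_ge0 ?mulr_ge0 ?addr_ge0.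
have d0 : 0 < e / K by rewrite divr_gt0.
have hs : \forall t \near U, `|fb_residual g0 A B (x t)| < e / K.
  by apply: sU; move/cvgr0Pnorm_lt : sV; apply.
have hr : \forall t \near U, `|ip q r - ip (x t) r| < e / K.
  by move/cvgrPdist_lt : (hq r); apply.
have ht : \forall t \near U, t1 <= t.
  by apply: sU; apply: nbhs_pinfty_ge; exact: num_real.
have [t [[ht1 ht2] ht3]] := filter_ex (filterI (filterI hs hr) ht).
have [XM _ _] := hM t ht3.
have := fb_residual_half_cocoercive ip_norm (sa_A std) (sa_B std) (x t) q adm0.
rewrite -/r -ip_norm; move: (fb_residual g0 A B (x t)) ht1 => s ht1.
rewrite !(ipBl ip s r) !(ipBr ip s r) (ipBl ip (x t) q r) (ipC ip r s) => hco.
have b1 := ip_le ip_norm s r; have b2 := ip_le ip_norm (x t - q) s.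
have b3 : `|x t - q| <= M + `|z - q|.
  by rewrite -(subrK z (x t)) -addrA; apply: le_trans (ler_normD _ _) _; rewrite lerD2r.
have b4 := ip_ge0 ip_norm s.
have eE : e / K * K = e by rewrite divfK// gt_eqF.
move: ht2; rewrite ltr_distl => /andP[_ ht2].
have c1 : `|s| * `|r| <= e / K * `|r| by apply: ler_wpM2r => //; exact: ltW.
have c2 : `|x t - q| * `|s| <= (M + `|z - q|) * (e / K) by apply: ler_pM => //; exact: ltW.
rewrite -eE; move: (e / K) ht2 c1 c2 => d ht2 c1 c2; rewrite /K; lra.
Unshelve. all: by end_near. Qed.

End convergence.

Theorem theorem4p3 (R : realType) (H : completeNormedModType R)
    (ip : {dot H for idfun}) (ip_norm : induces_norm ip)
    (t0 rho nu : R) (A : H -> set H) (B : H -> H) (p : params R)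
    (std : standing_assumptions ip t0 rho nu A B p)
    (x : R -> H) (sol : strong_solution t0 A B p x)
    (a m c : R -> R)
    (lyap : lyapunov_conditions t0 rho nu p a m c)
    (growth : growth_conditions t0 rho nu p a m c) :
  (forall xbar, zer (op_add A B) xbar ->
     exists l : R, `|x t - xbar| @[t --> +oo] --> l) /\
  (exists2 xinf, zer (op_add A B) xinf & weak_cvg ip x xinf).
Proof.
have limx xbar : zer (op_add A B) xbar -> exists l : R, `|x t - xbar| @[t --> +oo] --> l.
  by move=> zx; exact (dist_zer_cvg ip_norm std sol lyap growth zx).
split=> //; have [z zz] := sa_zer std.
apply: (opial ip_norm (sa_zer std) limx) => U q UU sU hq.
exact (weak_cluster_zer ip_norm std sol lyap growth zz UU sU hq).
Qed.
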